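(* Let $\mathbb{F}_q$ be a finite field with $q$ elements, let $\mathbb{P}^1$ be the projective line over $\mathbb{F}_q$, write $\mathcal{O}=\mathcal{O}_{\mathbb{P}^1}$, and let $x\in|\mathbb{P}^1|$ be a closed point of degree $5$. Then, up to isomorphism, the vector bundles $\mathcal{E}'$ which are Hecke modifications of $\mathcal{O}\oplus\mathcal{O}$ at $x$ with weight $1$ are exactly $$\mathcal{O}(-5)\oplus\mathcal{O},\qquad \mathcal{O}(-4)\oplus\mathcal{O}(-1),\qquad \mathcal{O}(-3)\oplus\mathcal{O}(-2),$$ and they occur with multiplicities $$q+1,\qquad q^3-q,\qquad q^5-q^3,$$ respectively.
   Context: Let $X$ be a smooth projective curve over a field and $x$ a closed point of $X$ with residue field $\mathbb{F}(x)$. $\mathcal{K}_x$ denotes the skyscraper sheaf supported at $x$ with stalk $\mathbb{F}(x)$. Vector bundles are identified with locally free sheaves. For vector bundles $\mathcal{E},\mathcal{E}'$ of the same rank, $\mathcal{E}'$ is called a Hecke modification of $\mathcal{E}$ at $x$ with weight $1$ if there is a short exact sequence of coherent sheaves $0\to\mathcal{E}'\to\mathcal{E}\to\mathcal{K}_x\to 0$. Two such sequences with the same middle term $\mathcal{E}$ (and possibly different outer terms) are isomorphic if there are isomorphisms between the left terms and between the right terms which, together with the identity of $\mathcal{E}$, form a commutative diagram; the isomorphism class is denoted $[\mathcal{E}'\xrightarrow{x}\mathcal{E}]$. Thus isomorphism classes correspond to subsheaves of $\mathcal{E}$ with quotient isomorphic to $\mathcal{K}_x$. The multiplicity of $\mathcal{E}'$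 as a Hecke modification of $\mathcal{E}$ at $x$ is the number of isomorphism classes $[\mathcal{E}''\xrightarrow{x}\mathcal{E}]$ with $\mathcal{E}''\cong\mathcal{E}'$. *)

(* Defs.v *)
From HB Require Import structures.
From mathcomp Require Import all_boot all_order all_algebra.
From mathcomp Require Import ring_quotient generic_quotient.
From mathcomp Require Import zify.
From mathcomp Require Import boolp classical_sets functions cardinality topology.

Set Implicit Arguments.
Unset Strict Implicit.
Unset Printing Implicit Defensive.

Import Order.TTheory GRing.Theory Num.Theory.

Local Open Scope classical_set_scope.
Local Open Scope ring_scope.

Record opens (X : topologicalType) := Opens {
  open_set :> set X;
  open_setP : open open_set }.

(* Compatibility is tested on every open set contained in both members of the
   cover, which amounts to testing it on their intersection.  The empty cover
   is allowed, so there is exactly one section over the empty set. *)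
Definition sheaf_axiom (X : topologicalType) (S : opens X -> Type)
    (res : forall U V : opens X, V `<=` U -> S U -> S V) : Prop :=
  forall (I : Type) (U : opens X) (W : I -> opens X)
    (WU : forall i, W i `<=` U) (s : forall i, S (W i)),
  (forall x, open_set U x -> exists i, open_set (W i) x) ->
  (forall i j (V : opens X) (Vi : V `<=` W i) (Vj : V `<=` W j),
     res _ _ Vi (s i) = res _ _ Vj (s j)) ->
  exists! t : S U, forall i, res _ _ (WU i) t = s i.

Record ring_sheaf (X : topologicalType) := RingSheaf {
  rsec :> opens X -> comPzRingType;
  rres : forall U V : opens X, V `<=` U -> {rmorphism rsec U -> rsec V};
  rres_id : forall (U : opens X) (UU : U `<=` U) s, rres UU s = s;
  rres_comp : forall (U V W : opens X)
    (VU : V `<=` U) (WV : W `<=` V) (WU : W `<=` U) s,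
    rres WV (rres VU s) = rres WU s;
  rsheafP : sheaf_axiom (fun U V (VU : V `<=` U) => rres VU : rsec U -> rsec V) }.

Arguments rres {X r U V}.

Record omodule (X : topologicalType) (O : ring_sheaf X) := OModule {
  msec :> forall U : opens X, lmodType (O U);
  mres : forall U V : opens X, V `<=` U -> {additive msec U -> msec V};
  mresZ : forall (U V : opens X) (VU : V `<=` U) (a : O U) s,
    mres VU (a *: s) = rres VU a *: mres VU s;
  mres_id : forall (U : opens X) (UU : U `<=` U) s, mres UU s = s;
  mres_comp : forall (U V W : opens X)
    (VU : V `<=` U) (WV : W `<=` V) (WU : W `<=` U) s,
    mres WV (mres VU s) = mres WU s;
  msheafP : sheaf_axiom (fun U V (VU : V `<=` U) => mres VU : msec U -> msec V) }.

Arguments mres {X O o U V}.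

Section Modules.
Variables (X : topologicalType) (O : ring_sheaf X).
Implicit Types M N : omodule O.

Record omor M N := OMor {
  omap :> forall U : opens X, {linear M U -> N U};
  omap_res : forall (U V : opens X) (VU : V `<=` U) s,
    omap V (mres VU s) = mres VU (omap U s) }.

Definition mutually_inverse M N (f : omor M N) (g : omor N M) : Prop :=
  forall U : opens X, cancel (f U) (g U) /\ cancel (g U) (f U).

Definition isomorphic M N : Prop :=
  exists (f : omor M N) (g : omor N M), mutually_inverse f g.

(* Sections of the image sheaf: local preimages need not glue. *)
Definition in_image M N (f : omor M N) (U : opens X) (s : N U) : Prop :=
  forall x, open_set U x -> exists (V : opens X) (VU : V `<=` U),
    open_set V x /\ exists t : M V, f V t = mres VU s.

Definition short_exact L M N (f : omor L M) (g : omor M N) : Prop :=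
  [/\ forall (U : opens X) (s : L U), f U s = 0 -> s = 0,
      forall (U : opens X) (s : M U), g U s = 0 <-> in_image f s
    & forall (U : opens X) (s : N U), in_image g s].

(* phi is an isomorphism from the restriction of O^r to U onto that of M. *)
Definition locally_free (r : nat) M : Prop :=
  forall x : X, exists U : opens X, open_set U x /\
  exists phi : forall V : opens X, V `<=` U -> {linear 'rV[O V]_r -> M V},
    (forall (V : opens X) (VU : V `<=` U), bijective (phi V VU)) /\
    (forall (V W : opens X) (VU : V `<=` U) (WU : W `<=` U) (WV : W `<=` V) c,
       phi W WU (map_mx (rres WV) c) = mres WV (phi V VU c)).

Record ses M (Q : omodule O) := SES {
  ses_left : omodule O;
  ses_inj : omor ses_left M;
  ses_proj : omor M Q;
  ses_exact : short_exact ses_inj ses_proj }.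

Definition ses_iso M (Q : omodule O) (s t : ses M Q) : Prop :=
  exists (f : omor (ses_left s) (ses_left t)) (f' : omor (ses_left t) (ses_left s))
         (g g' : omor Q Q),
    [/\ mutually_inverse f f', mutually_inverse g g',
        forall (U : opens X) u, ses_inj t U (f U u) = ses_inj s U u
      & forall (U : opens X) m, ses_proj t U m = g U (ses_proj s U m)].

Section SelfModule.

Definition self_res (U V : opens X) (VU : V `<=` U) : (O U)^o -> (O V)^o :=
  rres VU.

Lemma self_res_additive (U V : opens X) (VU : V `<=` U) :
  zmod_morphism (self_res VU).
Proof. exact: rmorphB. Qed.

HB.instance Definition _ (U V : opens X) (VU : V `<=` U) :=
  GRing.isZmodMorphism.Build (O U)^o (O V)^o (self_res VU)
    (self_res_additive VU).

Definition self_module : omodule O.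
Proof.
refine (@OModule X O (fun U => (O U)^o) (fun U V VU => self_res VU) _ _ _ _).
- by move=> U V VU a s; exact: (rmorphM (rres VU) a s).
- by move=> U UU s; exact: rres_id.
- by move=> U V W VU WV WU s; exact: rres_comp.
- exact: rsheafP.
Defined.

End SelfModule.

Section DirectSum.
Variables M N : omodule O.

Definition dsum_res (U V : opens X) (VU : V `<=` U) (s : M U * N U) : M V * N V :=
  (mres VU s.1, mres VU s.2).

Lemma dsum_res_additive (U V : opens X) (VU : V `<=` U) :
  zmod_morphism (dsum_res VU).
Proof. by move=> s t; rewrite /dsum_res /= !raddfB. Qed.

HB.instance Definition _ (U V : opens X) (VU : V `<=` U) :=
  GRing.isZmodMorphism.Build (M U * N U)%type (M V * N V)%type (dsum_res VU)
    (dsum_res_additive VU).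

Lemma dsum_sheafP :
  @sheaf_axiom X (fun U => M U * N U)%type (fun U V VU => dsum_res VU).
Proof.
move=> I U W WU s cov comp.
have [|t1 [t1P t1u]] := msheafP WU (s := fun i => (s i).1) cov.
  by move=> i j V Vi Vj; have := comp i j V Vi Vj; case.
have [|t2 [t2P t2u]] := msheafP WU (s := fun i => (s i).2) cov.
  by move=> i j V Vi Vj; have := comp i j V Vi Vj; case.
exists (t1, t2); split.
  by move=> i; rewrite /dsum_res /= t1P t2P -surjective_pairing.
case=> u1 u2 uP; congr pair; [apply: t1u | apply: t2u] => i;
  by rewrite -(uP i).
Qed.

Definition dsum : omodule O.
Proof.
refine (@OModule X O (fun U => M U * N U : lmodType (O U))%type
  (fun U V VU => dsum_res VU) _ _ _ dsum_sheafP).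
- by move=> U V VU a s; congr pair; apply: mresZ.
- by move=> U UU [s t]; rewrite /= /dsum_res /= !mres_id.
- by move=> U V W VU WV WU [s t]; rewrite /= /dsum_res /= !(mres_comp _ _ WU).
Defined.

End DirectSum.

End Modules.

Section ProjectiveLine.
Variable F : fieldType.

Notation K := {fraction {poly F}}.

Record monic_irreducible := MonicIrreducible {
  mi_poly :> {poly F};
  mi_monic : mi_poly \is monic;
  mi_irreducible : irreducible_poly mi_poly }.

(* Closed points of Spec F[t] are the ideals (p), for p monic irreducible; the
   projective line, with function field F(t), has one more closed point, where
   1/t is a local parameter. *)
Inductive closed_point := Finite of monic_irreducible | Infinity.

Inductive P1 := Generic | Closed of closed_point.

HB.instance Definition _ := gen_eqMixin P1.
HB.instance Definition _ := gen_choiceMixin P1.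

(* Zariski topology: a nonempty open set is the complement of finitely many
   closed points. *)
Definition P1_open (U : set P1) : Prop :=
  U = set0 \/ (U Generic /\ finite_set (~` U)).

Lemma P1_openT : P1_open setT.
Proof. by right; split => //; rewrite setCT. Qed.

Lemma P1_openI (A B : set P1) : P1_open A -> P1_open B -> P1_open (A `&` B).
Proof.
move=> [->|[gA fA]]; first by left; rewrite set0I.
move=> [->|[gB fB]]; first by left; rewrite setI0.
by right; split => //; rewrite setCI finite_setU.
Qed.

Lemma P1_open_bigU (I : Type) (f : I -> set P1) :
  (forall i, P1_open (f i)) -> P1_open (\bigcup_i f i).
Proof.
move=> fo; have [[i gi]|no] := pselect (exists i, f i Generic).
  right; split; first by exists i.
  have [fi0|[_ fin]] := fo i; first by rewrite fi0 in gi.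
  by apply: sub_finite_set fin => x nx fx; apply: nx; exists i.
left; rewrite -subset0 => x [i _ fix_].
have [fi0|[gi _]] := fo i; first by rewrite fi0 in fix_.
by case: no; exists i.
Qed.

HB.instance Definition _ :=
  isOpenTopological.Build P1 P1_openT P1_openI P1_open_bigU.

Notation "f %:K" := (FracField.tofrac f) (at level 2, left associativity, format "f %:K").

(* [ord_ge x n f]: the rational function f vanishes to order at least n at x
   (this holds for f = 0 whatever n is). *)
Definition ord_ge (x : closed_point) (n : int) (f : K) : Prop :=
  match x with
  | Finite p => exists a b : {poly F},
      ~~ (mi_poly p %| b) /\ f = (mi_poly p)%:K ^ n * (a%:K / b%:K)
  | Infinity => exists a b : {poly F},
      [/\ b != 0, f = a%:K / b%:K & (size a)%:Z + n <= (size b)%:Z]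
  end.

Lemma mi_ndvdM (p : monic_irreducible) (a b : {poly F}) :
  ~~ (mi_poly p %| a) -> ~~ (mi_poly p %| b) -> ~~ (mi_poly p %| a * b).
Proof.
move=> pa pb; rewrite Gauss_dvdpr //; have [_ irr] := mi_irreducible p.
rewrite /coprimep; apply/negPn/negP => s1.
have gp := irr _ s1 (dvdp_gcdl _ _).
by move: pa; rewrite -(eqp_dvdl _ gp) dvdp_gcdr.
Qed.

Lemma mi_ndvd_neq0 (p : monic_irreducible) (b : {poly F}) :
  ~~ (mi_poly p %| b) -> b%:K != 0.
Proof. by apply: contraNneq => /eqP; rewrite tofrac_eq0 => /eqP ->; exact: dvdp0. Qed.

Lemma mi_ndvd1 (p : monic_irreducible) : ~~ (mi_poly p %| 1).
Proof. by rewrite dvdp1; case: (mi_irreducible p); case: ltngtP. Qed.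

Lemma mi_neq0 (p : monic_irreducible) : (mi_poly p)%:K != 0.
Proof. by rewrite tofrac_eq0; exact: irredp_neq0 (mi_irreducible p). Qed.

Lemma ord_ge0 x n : ord_ge x n 0.
Proof.
case: x => [p|].
  exists 0, 1; split; first exact: mi_ndvd1.
  by rewrite tofrac0 mul0r mulr0.
exists 0, 'X^(absz n); split; first by rewrite monic_neq0 ?monicXn.
  by rewrite tofrac0 mul0r.
by rewrite size_poly0 size_polyXn; lia.
Qed.

Lemma ord_geC x (c : F) : ord_ge x 0 (c%:P)%:K.
Proof.
case: x => [p|]; exists c%:P, 1; split.
- exact: mi_ndvd1.
- by rewrite expr0z mul1r tofrac1 divr1.
- exact: oner_neq0.
- by rewrite tofrac1 divr1.
- by rewrite addr0 size_poly1; have := size_polyC_leq1 c; lia.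
Qed.

Lemma ord_ge1 x : ord_ge x 0 1.
Proof. by have := ord_geC x 1; rewrite tofrac1. Qed.

Lemma ord_geN x n f : ord_ge x n f -> ord_ge x n (- f).
Proof.
case: x => [p|] [a [b]] => [[nb ->]|[nb -> sab]]; exists (- a), b; split => //.
- by rewrite tofracN mulNr mulrN.
- by rewrite tofracN mulNr.
- by rewrite size_polyN.
Qed.

Lemma ord_geD x n f g : ord_ge x n f -> ord_ge x n g -> ord_ge x n (f + g).
Proof.
case: x => [p|] [a [b]].
  move=> [nb ->] [c [d [nd ->]]]; exists (a * d + c * b), (b * d).
  split; first exact: mi_ndvdM.
  rewrite -mulrDr tofracD !tofracM; congr (_ * _).
  by apply: addf_div; [exact: mi_ndvd_neq0 nb | exact: mi_ndvd_neq0 nd].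
move=> [nb -> sab] [c [d [nd -> scd]]]; exists (a * d + c * b), (b * d).
split.
- by rewrite mulf_neq0.
- by rewrite tofracD !tofracM; apply: addf_div; rewrite tofrac_eq0.
have arith (k l r u v : nat) : (k%:Z + n <= l%:Z) -> (r%:Z + n <= u%:Z) ->
    (0 < l)%N -> (0 < u)%N -> (v <= maxn (k + u).-1 (r + l).-1)%N ->
    v%:Z + n <= (l + u).-1%:Z by lia.
rewrite (size_mul nb nd); apply: (arith _ _ _ _ _ sab scd).
- by rewrite size_poly_gt0.
- by rewrite size_poly_gt0.
apply: leq_trans (size_polyD _ _) _; rewrite geq_max !leq_max.
by rewrite !size_mul_leq orbT.
Qed.

Lemma ord_geM x m n f g : ord_ge x m f -> ord_ge x n g -> ord_ge x (m + n) (f * g).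
Proof.
case: x => [p|] [a [b]].
  move=> [nb ->] [c [d [nd ->]]]; exists (a * c), (b * d).
  split; first exact: mi_ndvdM.
  by rewrite expfzDr ?mi_neq0 // !tofracM mulrACA mulf_div.
move=> [nb -> sab] [c [d [nd -> scd]]].
have [->|a0] := eqVneq a 0; first by rewrite tofrac0 !mul0r; exact: ord_ge0.
have [->|c0] := eqVneq c 0; first by rewrite tofrac0 mul0r mulr0; exact: ord_ge0.
exists (a * c), (b * d); split.
- by rewrite mulf_neq0.
- by rewrite !tofracM mulf_div.
have arith (k l r u : nat) : (k%:Z + m <= l%:Z) -> (r%:Z + n <= u%:Z) ->
    (0 < k)%N -> (0 < r)%N ->
    (k + r).-1%:Z + (m + n) <= (l + u).-1%:Z by lia.
by rewrite (size_mul nb nd) (size_mul a0 c0); apply: arith;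
  rewrite ?size_poly_gt0.
Qed.

Lemma ord_ge1_neq1 x : ~ ord_ge x 1 1.
Proof.
case: x => [p|] [a [b]].
  move=> [nb /eqP]; rewrite expr1z mulrA eq_sym -[X in X == _]/(_) .
  have b0 := mi_ndvd_neq0 nb.
  rewrite (can2_eq (divfK b0) (mulfK b0)) mul1r -tofracM => /eqP /eqP.
  rewrite tofrac_eq => /eqP pab; move: nb; rewrite -pab.
  by rewrite dvdp_mulr // dvdpp.
move=> [nb /eqP]; have b0 : b%:K != 0 by rewrite tofrac_eq0.
rewrite eq_sym (can2_eq (divfK b0) (mulfK b0)) mul1r tofrac_eq => /eqP ->.
by lia.
Qed.

Definition local_pred (x : closed_point) : {pred K} :=
  fun f => `[< ord_ge x 0 f >].

Record local_ring (x : closed_point) := LocalRing {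
  lval :> K;
  lvalP : lval \in local_pred x }.

Section LocalRing.
Variable x : closed_point.

HB.instance Definition _ := [isSub for @lval x].
HB.instance Definition _ := [Choice of local_ring x by <:].

Lemma local_subring : subring_closed (local_pred x).
Proof.
split; first by apply/asboolP; exact: ord_ge1.
- move=> f g /asboolP fP /asboolP gP; apply/asboolP.
  by apply: ord_geD => //; exact: ord_geN.
- move=> f g /asboolP fP /asboolP gP; apply/asboolP.
  by rewrite -[0]addr0; exact: ord_geM.
Qed.

HB.instance Definition _ := GRing.isSubringClosed.Build K (local_pred x) local_subring.
HB.instance Definition _ := [SubChoice_isSubComNzRing of local_ring x by <:].

Definition max_ideal : {pred local_ring x} := fun f => `[< ord_ge x 1 (lval f) >].

Lemma max_ideal_closed : idealr_closed max_ideal.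
Proof.
split; first by apply/asboolP; exact: ord_ge0.
- by apply/asboolP; exact: ord_ge1_neq1.
move=> a u v /asboolP uP /asboolP vP; apply/asboolP.
apply: ord_geD => //; rewrite -[1]add0r.
by apply: ord_geM => //; apply/asboolP; exact: lvalP.
Qed.

HB.instance Definition _ := isIdealr.Build (local_ring x) max_ideal max_ideal_closed.

Definition residue_field := {ideal_quot max_ideal}.

HB.instance Definition _ := GRing.ComNzRing.on residue_field.

Definition residue (f : local_ring x) : residue_field :=
  (\pi_({ideal_quot max_ideal}) f)%qT.

Lemma residueB : zmod_morphism residue.
Proof. exact: rmorphB. Qed.

Lemma residueM : monoid_morphism residue.
Proof. by split; [exact: rmorph1 | exact: rmorphM]. Qed.

HB.instance Definition _ := GRing.isZmodMorphism.Build
  (local_ring x) residue_field residue residueB.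
HB.instance Definition _ := GRing.isMonoidMorphism.Build
  (local_ring x) residue_field residue residueM.

Definition const_residue (a : F) : residue_field :=
  residue (@LocalRing x (a%:P)%:K (introT (asboolP _) (ord_geC x a))).

(* The degree [F(x) : F] is d: the residue field has an F-basis e of size d. *)
Definition has_degree (d : nat) : Prop :=
  exists e : 'I_d -> residue_field, forall z, exists! a : {ffun 'I_d -> F},
    z = \sum_i const_residue (a i) * e i.

End LocalRing.

Arguments max_ideal : clear implicits.

Definition twist (n : int) (x : closed_point) : int :=
  if x is Infinity then n else 0.

(* The stalk at x of O(n), viewed inside K as that of the divisor n[Infinity]. *)
Definition twist_stalk (n : int) (x : P1) (f : K) : Prop :=
  if x is Closed c then ord_ge c (- twist n c) f else True.

Definition points (U : opens P1) := {x : P1 | open_set U x}.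

(* A section of O(n) over a nonempty U is a rational function lying in the
   stalks of O(n) at the points of U.  Writing it as a constant function on U
   makes the zero module the value of O(n) on the empty set. *)
Definition is_section (n : int) (U : opens P1) (s : points U -> K) : Prop :=
  (forall x y, s x = s y) /\ (forall x, twist_stalk n (sval x) (s x)).

Definition section_pred (n : int) (U : opens P1) : {pred points U -> K} :=
  fun s => `[< is_section n s >].
Arguments section_pred : clear implicits.

Lemma twist_stalkB n x f g :
  twist_stalk n x f -> twist_stalk n x g -> twist_stalk n x (f - g).
Proof. by case: x => //= c fP gP; apply: ord_geD => //; exact: ord_geN. Qed.

Lemma twist_stalkM n x f g :
  twist_stalk 0 x f -> twist_stalk n x g -> twist_stalk n x (f * g).
Proof.
case: x => //= c fP gP; rewrite -[- _]add0r; apply: ord_geM => //.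
by case: c fP {gP}.
Qed.

Lemma section_zmod n U : zmod_closed (section_pred n U).
Proof.
split.
  by apply/asboolP; split => // -[[|c] Uc] //=; exact: ord_ge0.
move=> s t /asboolP[s1 s2] /asboolP[t1 t2]; apply/asboolP; split.
  by move=> x y; rewrite !fctE (s1 x y) (t1 x y).
by move=> x; apply: twist_stalkB.
Qed.

Lemma section_subring U : subring_closed (section_pred 0 U).
Proof.
split.
- apply/asboolP; split => // -[[|c] Uc] //=.
  by rewrite (_ : twist 0 c = 0) ?oppr0; [exact: ord_ge1 | case: c {Uc}].
- by case: (section_zmod 0 U).
move=> s t /asboolP[s1 s2] /asboolP[t1 t2]; apply/asboolP; split.
  by move=> x y; rewrite !fctE (s1 x y) (t1 x y).
by move=> x; apply: twist_stalkM.
Qed.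

Definition restrict (U V : opens P1) (VU : V `<=` U) (T : Type)
    (s : points U -> T) : points V -> T :=
  fun x => s (exist _ (sval x) (VU _ (proj2_sig x))).

Lemma restrict_section n (U V : opens P1) (VU : V `<=` U) s :
  is_section n s -> is_section n (restrict VU s).
Proof. by move=> [s1 s2]; split => [x y|x]; [exact: s1 | exact: (s2 (exist _ _ _))]. Qed.

Lemma open_Generic (U : opens P1) x : open_set U x -> open_set U Generic.
Proof.
by move=> Ux; case: (open_setP U) => [U0|[]//]; move: Ux; rewrite U0.
Qed.

Lemma section_sheaf n (I : Type) (U : opens P1) (W : I -> opens P1)
    (WU : forall i, W i `<=` U) (s : forall i, points (W i) -> K) :
  (forall x, open_set U x -> exists i, open_set (W i) x) ->
  (forall i, is_section n (s i)) ->
  (forall i j (V : opens P1) (Vi : V `<=` W i) (Vj : V `<=` W j),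
     restrict Vi (s i) = restrict Vj (s j)) ->
  exists2 t : points U -> K, is_section n t & forall i, restrict (WU i) t = s i.
Proof.
move=> cov sP comp.
have sE i j (x : points (W i)) (y : points (W j)) : s i x = s j y.
  have gi := open_Generic (proj2_sig x); have gj := open_Generic (proj2_sig y).
  have oV : open (open_set (W i) `&` open_set (W j)).
    by apply: openI; exact: open_setP.
  have := comp i j (Opens oV) (@subIsetl _ _ _) (@subIsetr _ _ _).
  move=> /(congr1 (fun f => f (exist _ Generic (conj gi gj)))) e.
  rewrite ((sP i).1 x (exist _ _ gi)) ((sP j).1 y (exist _ _ gj)).
  move: e; rewrite /restrict /=.
  by rewrite (Prop_irrelevance (subIsetl _) gi) (Prop_irrelevance (subIsetr _) gj).
pose idx (x : points U) := projT1 (cid (cov _ (proj2_sig x))).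
have idxP x : open_set (W (idx x)) (sval x) := projT2 (cid (cov _ (proj2_sig x))).
exists (fun x => s (idx x) (exist _ _ (idxP x))); first split.
- by move=> x y; exact: sE.
- by move=> x; exact: ((sP (idx x)).2 (exist _ _ (idxP x))).
- by move=> i; apply/funext => x; exact: sE.
Qed.

Lemma section_ext (T : Type) (I : Type) (U : opens P1) (W : I -> opens P1)
    (WU : forall i, W i `<=` U) (s t : points U -> T) :
  (forall x, open_set U x -> exists i, open_set (W i) x) ->
  (forall i, restrict (WU i) s = restrict (WU i) t) -> s = t.
Proof.
move=> cov st; apply/funext => -[x Ux]; have [i Wx] := cov x Ux.
have := congr1 (fun f => f (exist _ x Wx)) (st i).
by rewrite /restrict /= (Prop_irrelevance (WU i x Wx) Ux).
Qed.

Record structure_section (U : opens P1) := StructureSection {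
  osval :> points U -> K;
  osvalP : osval \in section_pred 0 U }.

Record twist_section (n : int) (U : opens P1) := TwistSection {
  tsval :> points U -> K;
  tsvalP : tsval \in section_pred n U }.

Section Instances.
Variables (n : int) (U : opens P1).

HB.instance Definition _ := GRing.isZmodClosed.Build (points U -> K)
  (section_pred n U) (section_zmod n U).
HB.instance Definition _ := [isSub for @tsval n U].
HB.instance Definition _ := [Choice of twist_section n U by <:].
HB.instance Definition _ := [SubChoice_isSubZmodule of twist_section n U by <:].

HB.instance Definition _ := GRing.isSubringClosed.Build (points U -> K)
  (section_pred 0 U) (section_subring U).
HB.instance Definition _ := [isSub for @osval U].
HB.instance Definition _ := [Choice of structure_section U by <:].
HB.instance Definition _ := GRing.SubChoice_isSubComPzRing.Build
  (points U -> K) (section_pred 0 U) (structure_section U) (section_subring U).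

Lemma twist_scale_subproof (a : structure_section U) (s : twist_section n U) :
  (osval a * tsval s) \in section_pred n U.
Proof.
have /asboolP[a1 a2] := osvalP a; have /asboolP[s1 s2] := tsvalP s.
apply/asboolP; split => [x y|x]; last exact: twist_stalkM.
by rewrite !fctE (a1 x y) (s1 x y).
Qed.

Definition twist_scale (a : structure_section U) (s : twist_section n U) :=
  TwistSection (twist_scale_subproof a s).

Lemma twist_scaleA a b s :
  twist_scale a (twist_scale b s) = twist_scale (a * b) s.
Proof. by apply: val_inj; exact: mulrA. Qed.

Lemma twist_scale1 : left_id 1 twist_scale.
Proof. by move=> s; apply: val_inj; exact: mul1r. Qed.

Lemma twist_scaleDr : right_distributive twist_scale +%R.
Proof. by move=> a s t; apply: val_inj; exact: mulrDr. Qed.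

Lemma twist_scaleDl s : {morph twist_scale^~ s : a b / a + b}.
Proof. by move=> a b; apply: val_inj; exact: mulrDl. Qed.

HB.instance Definition _ := GRing.Zmodule_isLmodule.Build
  (structure_section U) (twist_section n U)
  twist_scaleA twist_scale1 twist_scaleDr twist_scaleDl.

End Instances.

Section Restriction.
Variables (U V : opens P1) (VU : V `<=` U).

Lemma restrict_subproof n s :
  s \in section_pred n U -> restrict VU s \in section_pred n V.
Proof. by move=> /asboolP sP; apply/asboolP; exact: restrict_section. Qed.

Definition structure_res (s : structure_section U) : structure_section V :=
  StructureSection (restrict_subproof (osvalP s)).

Definition twist_res n (s : twist_section n U) : twist_section n V :=
  TwistSection (restrict_subproof (tsvalP s)).

Lemma structure_resB : zmod_morphism structure_res.
Proof. by move=> s t; apply: val_inj. Qed.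

Lemma structure_resM : monoid_morphism structure_res.
Proof. by split => [|s t]; apply: val_inj. Qed.

HB.instance Definition _ := GRing.isZmodMorphism.Build
  (structure_section U) (structure_section V) structure_res structure_resB.
HB.instance Definition _ := GRing.isMonoidMorphism.Build
  (structure_section U) (structure_section V) structure_res structure_resM.

Lemma twist_resB n : zmod_morphism (@twist_res n).
Proof. by move=> s t; apply: val_inj. Qed.

HB.instance Definition _ n := GRing.isZmodMorphism.Build
  (twist_section n U) (twist_section n V) (@twist_res n) (@twist_resB n).

End Restriction.

Lemma restrict_id (T : Type) (U : opens P1) (UU : U `<=` U) (s : points U -> T) :
  restrict UU s = s.
Proof.
by apply/funext => -[x Ux]; rewrite /restrict /= (Prop_irrelevance (UU x Ux) Ux).
Qed.

Lemma restrict_comp (T : Type) (U V W : opens P1) (VU : V `<=` U) (WV : W `<=` V)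
    (WU : W `<=` U) (s : points U -> T) :
  restrict WV (restrict VU s) = restrict WU s.
Proof.
apply/funext => -[x Wx]; rewrite /restrict /=.
by rewrite (Prop_irrelevance (VU x (WV x Wx)) (WU x Wx)).
Qed.

Definition structure_sheaf : ring_sheaf P1.
Proof.
refine (@RingSheaf P1 (fun U => structure_section U)
  (fun U V VU => structure_res VU) _ _ _).
- by move=> U UU s; apply: val_inj; exact: restrict_id.
- by move=> U V W VU WV WU s; apply: val_inj; exact: restrict_comp.
move=> I U W WU s cov comp.
have [||t tP tE] := section_sheaf WU (s := fun i => s i) cov (n := 0).
- by move=> i; apply/asboolP; exact: osvalP.
- by move=> i j V Vi Vj; exact: (congr1 (@osval _) (comp i j V Vi Vj)).
have tP' : t \in section_pred 0 U by apply/asboolP.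
exists (StructureSection tP'); split.
  by move=> i; apply: val_inj; exact: tE.
move=> u uE; apply: val_inj; apply: section_ext cov _ => i.
by rewrite tE -(uE i).
Defined.

Definition O_ (n : int) : omodule structure_sheaf.
Proof.
refine (@OModule P1 structure_sheaf (fun U => twist_section n U)
  (fun U V VU => @twist_res U V VU n) _ _ _ _).
- by move=> U V VU a s; apply: val_inj.
- by move=> U UU s; apply: val_inj; exact: restrict_id.
- by move=> U V W VU WV WU s; apply: val_inj; exact: restrict_comp.
move=> I U W WU s cov comp.
have [||t tP tE] := section_sheaf WU (s := fun i => s i) cov (n := n).
- by move=> i; apply/asboolP; exact: tsvalP.
- by move=> i j V Vi Vj; exact: (congr1 (@tsval _ _) (comp i j V Vi Vj)).
have tP' : t \in section_pred n U by apply/asboolP.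
exists (TwistSection tP'); split.
  by move=> i; apply: val_inj; exact: tE.
move=> u uE; apply: val_inj; apply: section_ext cov _ => i.
by rewrite tE -(uE i).
Defined.

Section Skyscraper.
Variable c : closed_point.

Lemma germ_subproof (U : opens P1) (Uc : open_set U (Closed c))
  (a : structure_section U) : osval a (exist _ _ Uc) \in local_pred c.
Proof.
have /asboolP[_ /(_ (exist _ _ Uc)) /=] := osvalP a; rewrite /twist_stalk /=.
by rewrite (_ : - twist 0 c = 0) => [?|]; [apply/asboolP | case: c {Uc}].
Qed.

Definition value_at (U : opens P1) (Uc : open_set U (Closed c))
    (a : structure_section U) : residue_field c :=
  residue (LocalRing (germ_subproof Uc a)).

Lemma value_atB U Uc : zmod_morphism (@value_at U Uc).
Proof. by move=> a b; rewrite /value_at -rmorphB; congr residue; exact: val_inj. Qed.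

Lemma value_atM U Uc : monoid_morphism (@value_at U Uc).
Proof.
split => [|a b]; rewrite /value_at.
  by rewrite -(rmorph1 (@residue c)); congr residue; exact: val_inj.
by rewrite -rmorphM; congr residue; exact: val_inj.
Qed.

HB.instance Definition _ U Uc := GRing.isZmodMorphism.Build
  (structure_section U) (residue_field c) (@value_at U Uc) (value_atB Uc).
HB.instance Definition _ U Uc := GRing.isMonoidMorphism.Build
  (structure_section U) (residue_field c) (@value_at U Uc) (value_atM Uc).

(* F(c) if c lies in U, and 0 otherwise. *)
Definition sky_section (U : opens P1) : Type :=
  open_set U (Closed c) -> residue_field c.

HB.instance Definition _ U := GRing.Zmodule.on (sky_section U).

Definition sky_scale (U : opens P1) (a : structure_section U) (s : sky_section U) :
  sky_section U := fun Uc => value_at Uc a * s Uc.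

Section SkyModule.
Variable U : opens P1.

Lemma sky_scaleA a b (s : sky_section U) :
  sky_scale a (sky_scale b s) = sky_scale (a * b) s.
Proof. by apply/funext => Uc; rewrite /sky_scale rmorphM mulrA. Qed.

Lemma sky_scale1 : left_id 1 (@sky_scale U).
Proof. by move=> s; apply/funext => Uc; rewrite /sky_scale rmorph1 mul1r. Qed.

Lemma sky_scaleDr : right_distributive (@sky_scale U) +%R.
Proof. by move=> a s t; apply/funext => Uc; exact: mulrDr. Qed.

Lemma sky_scaleDl s : {morph (@sky_scale U)^~ s : a b / a + b}.
Proof.
move=> a b; apply/funext => Uc; rewrite /sky_scale rmorphD; exact: mulrDl.
Qed.

HB.instance Definition _ := GRing.Zmodule_isLmodule.Build
  (structure_section U) (sky_section U)
  sky_scaleA sky_scale1 sky_scaleDr sky_scaleDl.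

End SkyModule.

Definition sky_res (U V : opens P1) (VU : V `<=` U) (s : sky_section U) :
  sky_section V := fun Vc => s (VU _ Vc).

Lemma sky_resB (U V : opens P1) (VU : V `<=` U) : zmod_morphism (sky_res VU).
Proof. by []. Qed.

HB.instance Definition _ (U V : opens P1) (VU : V `<=` U) :=
  GRing.isZmodMorphism.Build (sky_section U) (sky_section V) (sky_res VU)
    (sky_resB VU).

Lemma value_at_res (U V : opens P1) (VU : V `<=` U) a Vc Uc :
  value_at Vc (structure_res VU a) = value_at Uc a.
Proof.
congr residue; apply: val_inj; rewrite /= /restrict /=.
by rewrite (Prop_irrelevance (VU _ Vc) Uc).
Qed.

Definition skyscraper : omodule structure_sheaf.
Proof.
refine (@OModule P1 structure_sheaf (fun U => sky_section U)
  (fun U V VU => sky_res VU) _ _ _ _).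
- move=> U V VU a s; apply/funext => Vc.
  by rewrite /sky_res /= /GRing.scale /= /sky_scale (value_at_res VU a Vc (VU _ Vc)).
- by move=> U UU s; apply/funext => Uc; congr s; exact: Prop_irrelevance.
- by move=> U V W VU WV WU s; apply/funext => Wc; congr s; exact: Prop_irrelevance.
move=> I U W WU s cov comp.
have sE i j (ic : open_set (W i) (Closed c)) (jc : open_set (W j) (Closed c)) :
    s i ic = s j jc.
  have oV : open (open_set (W i) `&` open_set (W j)).
    by apply: openI; exact: open_setP.
  have := comp i j (Opens oV) (@subIsetl _ _ _) (@subIsetr _ _ _).
  move=> /(congr1 (fun f : sky_section (Opens oV) => f (conj ic jc))) /= e.
  apply: etrans (etrans e _); congr (s _); exact: Prop_irrelevance.
exists (fun Uc => s (projT1 (cid (cov _ Uc))) (projT2 (cid (cov _ Uc)))); split.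
  by move=> i; apply/funext => ic; exact: sE.
move=> u uE; apply/funext => Uc; set i := projT1 _; set ic := projT2 _.
by rewrite -(uE i) /= /sky_res; congr u; exact: Prop_irrelevance.
Defined.

End Skyscraper.

Definition hecke_modification (x : closed_point) (E' E : omodule structure_sheaf) :
    Prop :=
  exists r, [/\ locally_free r E, locally_free r E' &
    exists (f : omor E' E) (g : omor E (skyscraper x)), short_exact f g].

(* s is a system of representatives for the isomorphism classes of sequences
   whose left term is isomorphic to E'. *)
Definition has_multiplicity (x : closed_point) (E' E : omodule structure_sheaf)
    (n : nat) : Prop :=
  exists s : 'I_n -> ses E (skyscraper x),
    [/\ forall i, isomorphic (ses_left (s i)) E',
        forall i j, ses_iso (s i) (s j) -> i = j
      & forall t : ses E (skyscraper x), isomorphic (ses_left t) E' ->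
          exists i, ses_iso t (s i)].

End ProjectiveLine.

Arguments O_ {F} n.

(* Main.v *)
From mathcomp Require Import all_boot all_order all_algebra.
From HB Require Import structures.
From mathcomp Require Import ring_quotient generic_quotient zify ring.
From mathcomp Require Import boolp classical_sets functions cardinality topology.
Require Import Defs.

Set Implicit Arguments.
Unset Strict Implicit.
Unset Printing Implicit Defensive.

Import GRing.Theory.
Local Open Scope classical_set_scope.
Local Open Scope ring_scope.

(** A closed point [x] of degree 5 is given by a monic irreducible polynomial [p]
    of degree 5, since the point at infinity has degree 1.  A surjection from
    O + O onto the skyscraper at [x] sends the two basis sections to the residues
    of polynomials [A] and [B], not both divisible by [p], and its isomorphism
    class is the point [[A : B]] of the projective line over the residue field
    ([represents_iso]).  So there are q^5 + 1 classes.

    The left term depends on how simply [[A : B]] can be written.  By the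
    pigeonhole principle [[A : B]] is the reduction modulo [p] of a rational
    function [f / g] of some degree [d <= 2], with [f] and [g] coprime
    ([has_height_exists]).  Then [(g, - f)] is a section of the kernel with a pole
    of order at most [d] at infinity.  A Bezout identity [g * u + f * w = p] with
    [u] and [w] of degree at most [5 - d] ([bezout_bounded]) provides a second
    section [(w, u)].  The determinant of the two is [p], and Cramer's rule shows
    that they form a basis of the kernel at every closed point, so that the left
    term is O(d - 5) + O(- d) ([reduced_basis_ses]).  These bundles are pairwise
    not isomorphic, because O(m) has no nonzero morphism to O(n) for [n < m]
    ([omor_O_zero]); hence [d], the height of the point, and the isomorphism class
    of the left term determine each other.

    It remains to count the points of each height.  Two rational functions of
    degree [d] that agree modulo [p] are equal if [2 * d < 5]
    ([card_stratum]), so these points correspond to the rational functions of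
    degree [d].  There are q + 1 of degree 0, including infinity, and q^3 - q of
    degree 1; the other q^5 - q^3 points have height 2. *)

(** * Morphisms and exact sequences of sheaves of modules *)

Section Morphisms.
Variables (X : topologicalType) (O : ring_sheaf X).
Implicit Types L M N : omodule O.

Section MakeMorphism.
Variables (M N : omodule O) (f : forall U : opens X, M U -> N U).
Hypothesis f_lin : forall U, linear (@f U).

HB.instance Definition _ (U : opens X) :=
  GRing.isLinear.Build (O U) (M U) (N U) *:%R (@f U) (@f_lin U).

Definition make_omor_at (U : opens X) : {linear M U -> N U} := @f U.

Hypothesis f_res : forall (U V : opens X) (VU : V `<=` U) s,
  @f V (mres VU s) = mres VU (@f U s).

Definition make_omor : omor M N := @OMor X O M N make_omor_at f_res.

Lemma make_omorE U s : make_omor U s = @f U s.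
Proof. by []. Qed.

End MakeMorphism.

Definition omor_comp L M N (g : omor M N) (f : omor L M) : omor L N.
Proof.
apply: (@make_omor L N (fun U s => g U (f U s))) => [U a s t|U V VU s].
  by rewrite !linearP.
by rewrite !omap_res.
Defined.

Lemma isomorphic_sym M N : isomorphic M N -> isomorphic N M.
Proof. by move=> [f [g fg]]; exists g, f => U; have [] := fg U. Qed.

Lemma isomorphic_refl M : isomorphic M M.
Proof.
pose i := @make_omor M M (fun U s => s) (fun U a s t => erefl)
  (fun U V VU s => erefl).
by exists i, i.
Qed.

Lemma isomorphic_trans L M N :
  isomorphic L M -> isomorphic M N -> isomorphic L N.
Proof.
move=> [f [f' ff']] [g [g' gg']].
exists (omor_comp g f), (omor_comp f' g') => U.
have [fK f'K] := ff' U; have [gK g'K] := gg' U.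
by split => s; rewrite /= /make_omor_at ?gK ?fK ?f'K ?g'K.
Qed.

Lemma isomorphic_dsum M M' N N' :
  isomorphic M M' -> isomorphic N N' -> isomorphic (dsum M N) (dsum M' N').
Proof.
move=> [f [f' ff']] [g [g' gg']].
have mk (A A' B B' : omodule O) (h : omor A A') (k : omor B B') :
    exists m : omor (dsum A B) (dsum A' B'),
      forall U s, m U s = (h U s.1, k U s.2).
  unshelve eexists.
    refine (@make_omor (dsum A B) (dsum A' B')
      (fun U (s : A U * B U) => ((h U s.1, k U s.2) : A' U * B' U)%type) _ _)
      => [U a s t|U V VU s].
      by congr pair; rewrite /= linearP.
    by congr pair; rewrite /= omap_res.
  by [].
have [m mE] := mk _ _ _ _ f g; have [m' m'E] := mk _ _ _ _ f' g'.
exists m, m' => U; have [fK f'K] := ff' U; have [gK g'K] := gg' U.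
by split => -[s t]; rewrite ?mE ?m'E /= ?fK ?gK ?f'K ?g'K // mE.
Qed.

Lemma locally_free_iso r M N :
  isomorphic M N -> locally_free r M -> locally_free r N.
Proof.
move=> [f [g fg]] Mfree x; have [U [Ux [phi [bij res]]]] := Mfree x.
exists U; split => //.
have lin (V : opens X) (VU : V `<=` U) : linear (fun c => f V (phi V VU c)).
  by move=> a s t; rewrite !linearP.
pose psi (V : opens X) (VU : V `<=` U) : {linear 'rV[O V]_r -> N V} :=
  HB.pack (fun c => f V (phi V VU c))
    (GRing.isLinear.Build _ _ _ _ _ (lin V VU)).
exists psi; split => [V VU|V W VU WU WV c].
  apply: (@bij_comp _ _ _ (f V) (phi V VU)); last exact: bij.
  by have [fK gK] := fg V; exists (g V).
by rewrite /= (res _ _ VU) omap_res.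
Qed.

Lemma short_exact_inj L M N (f : omor L M) (g : omor M N) (U : opens X) :
  short_exact f g -> injective (f U).
Proof.
by move=> [inj _ _] a b ab; apply/subr0_eq/inj; rewrite linearB /= ab subrr.
Qed.

(** The local preimages given by exactness agree on overlaps because the left
    map is injective, so they glue. *)
Lemma kernel_section L M N (f : omor L M) (g : omor M N) (U : opens X) s :
  short_exact f g -> g U s = 0 -> exists u, f U u = s.
Proof.
move=> fg; have [_ ker _] := fg => /ker loc.
have finj (V : opens X) : injective (f V).
  exact: short_exact_inj fg.
pose I := {x | open_set U x}.
have loc' (i : I) : {W : opens X & {WU : W `<=` U &
    {t : L W | open_set W (sval i) /\ f W t = mres WU s}}}.
  have /cid[W /cid[WU [Wx /cid[t tE]]]] := loc _ (proj2_sig i).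
  by exists W, WU, t.
pose W i := projT1 (loc' i); pose WU i := projT1 (projT2 (loc' i)).
pose t i := sval (projT2 (projT2 (loc' i))).
have tP i : open_set (W i) (sval i) /\ f (W i) (t i) = mres (WU i) s.
  exact: proj2_sig (projT2 (projT2 (loc' i))).
have cov x : open_set U x -> exists i, open_set (W i) x.
  by move=> Ux; exists (exist _ x Ux); have [] := tP (exist _ x Ux).
have [|u [uP _]] := msheafP WU (s := t) cov.
  move=> i j V Vi Vj; apply: finj; rewrite !omap_res (tP i).2 (tP j).2.
  have VU : V `<=` U by move=> y /Vi /(WU i).
  by rewrite !(mres_comp _ _ VU).
exists u.
have [|v [_ vu]] := msheafP WU (s := fun i => mres (WU i) s) cov.
  move=> i j V Vi Vj; have VU : V `<=` U by move=> y /Vi /(WU i).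
  by rewrite !(mres_comp _ _ VU).
rewrite -(vu s) // -(vu (f U u)) // => i.
by rewrite -omap_res uP (tP i).2.
Qed.

Lemma image_in_kernel L M N (f : omor L M) (g : omor M N) (U : opens X) u :
  short_exact f g -> g U (f U u) = 0.
Proof.
move=> [_ ker _]; apply/ker => x Ux.
by exists U, (fun y h => h); split => //; exists u; rewrite mres_id.
Qed.

(** A section of [L] is the unique preimage of a section of the kernel of [g];
    in the second sequence the same section has a unique preimage in [L']. *)
Lemma same_kernel_factor L L' M N N' (f : omor L M) (g : omor M N)
    (f' : omor L' M) (g' : omor M N') :
  short_exact f g -> short_exact f' g' ->
  (forall (U : opens X) s, g U s = 0 -> g' U s = 0) ->
  exists h : omor L L', forall U u, f' U (h U u) = f U u.
Proof.
move=> fg fg' sub.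
have inj' (V : opens X) : injective (f' V).
  exact: short_exact_inj fg'.
have ex U u : {v | f' U v = f U u}.
  by apply/cid/(kernel_section fg')/sub/(image_in_kernel _ fg).
pose h U u := sval (ex U u).
have hE U u : f' U (h U u) = f U u by exact: (proj2_sig (ex U u)).
unshelve eexists.
  apply: (@make_omor L L' h) => [U a s t|U V VU s]; apply: inj'.
    by rewrite linearP !hE linearP.
  by rewrite hE !omap_res hE.
by move=> U u; rewrite make_omorE hE.
Qed.

Lemma same_kernel_iso L L' M N N' (f : omor L M) (g : omor M N)
    (f' : omor L' M) (g' : omor M N') :
  short_exact f g -> short_exact f' g' ->
  (forall (U : opens X) s, g U s = 0 <-> g' U s = 0) ->
  exists (h : omor L L') (h' : omor L' L),
    mutually_inverse h h' /\ forall U u, f' U (h U u) = f U u.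
Proof.
move=> fg fg' same.
have [|h hE] := same_kernel_factor fg fg'; first by move=> U s /same.
have [|h' h'E] := same_kernel_factor fg' fg; first by move=> U s /same.
exists h, h'; split => // U.
have inj (V : opens X) : injective (f V).
  exact: short_exact_inj fg.
have inj' (V : opens X) : injective (f' V).
  exact: short_exact_inj fg'.
by split => s; [apply: inj; rewrite h'E hE | apply: inj'; rewrite hE h'E].
Qed.

Lemma ses_iso_left M (Q : omodule O) (s t : ses M Q) :
  ses_iso s t -> isomorphic (ses_left s) (ses_left t).
Proof. by move=> [f [f' [_ [_ [ff' _ _ _]]]]]; exists f, f'. Qed.

Lemma ses_iso_kernel M (Q : omodule O) (s t : ses M Q) U m :
  ses_iso s t -> ses_proj s U m = 0 -> ses_proj t U m = 0.
Proof. by move=> [f [f' [g [g' [_ _ _ ->]]]]] ->; rewrite raddf0. Qed.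

End Morphisms.

(** * Orders of vanishing and residues *)

Notation "f %:K" := (FracField.tofrac f)
  (at level 2, left associativity, format "f %:K").

Section Orders.
Variable F : fieldType.
Notation K := {fraction {poly F}}.
Implicit Types (c : closed_point F) (P Q : {poly F}) (k : K) (m n : int).

Lemma ord_ge_mono c m n k : m <= n -> ord_ge c n k -> ord_ge c m k.
Proof.
case: c => [p|] mn [a [b]].
  move=> [nb ->]; exists (mi_poly p ^+ `|n - m|%N * a), b; split => //.
  rewrite tofracM rmorphXn /= exprnP -[in RHS]mulrA [RHS]mulrA -expfzDr ?mi_neq0 //.
  by congr (_ ^ _ * _); lia.
by move=> [nb -> sab]; exists a, b; split => //; lia.
Qed.

Lemma ord_geMl c n k k' : ord_ge c 0 k -> ord_ge c n k' -> ord_ge c n (k * k').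
Proof. by move=> k0 kn; rewrite -[n]add0r; exact: ord_geM. Qed.

Lemma ord_geB c n k k' : ord_ge c n k -> ord_ge c n k' -> ord_ge c n (k - k').
Proof. by move=> kn kn'; apply: ord_geD => //; exact: ord_geN. Qed.

Lemma ord_ge_poly (p : monic_irreducible F) P : ord_ge (Finite p) 0 P%:K.
Proof.
exists P, 1; split; first exact: mi_ndvd1.
by rewrite expr0z mul1r tofrac1 divr1.
Qed.

Lemma ord_ge_infty_poly P n :
  (size P)%:Z <= n + 1 -> ord_ge (Infinity F) (- n) P%:K.
Proof.
move=> sP; exists P, 1; split; first exact: oner_neq0.
  by rewrite tofrac1 divr1.
by rewrite size_poly1; lia.
Qed.

Lemma ord_ge_infty_polyV P n : P != 0 ->
  n < (size P)%:Z -> ord_ge (Infinity F) n (P%:K)^-1.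
Proof.
move=> P0 sP; exists 1, P; split => //; first by rewrite tofrac1 mul1r.
by rewrite size_poly1; lia.
Qed.

Lemma ord_ge_polyV (p : monic_irreducible F) P :
  ~~ (mi_poly p %| P) -> ord_ge (Finite p) 0 (P%:K)^-1.
Proof. by move=> pP; exists 1, P; split => //; rewrite expr0z tofrac1 !mul1r. Qed.

Lemma ord_ge1_poly (p : monic_irreducible F) P :
  ord_ge (Finite p) 1 P%:K <-> mi_poly p %| P.
Proof.
split=> [[a [b [nb]]]|/dvdpP[Q ->]].
  rewrite expr1z => /eqP; have b0 := mi_ndvd_neq0 nb.
  rewrite mulrA -(can2_eq (mulfK b0) (divfK b0)).
  rewrite -!tofracM tofrac_eq => /eqP Pb; apply: contraTT isT => nP.
  by have := mi_ndvdM nP nb; rewrite Pb dvdp_mulIl.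
exists Q, 1; split; first exact: mi_ndvd1.
by rewrite expr1z tofrac1 divr1 tofracM mulrC.
Qed.

Lemma mi_dvd_mi (p r : monic_irreducible F) :
  mi_poly r %| mi_poly p -> r = p.
Proof.
move=> rp; have sr : size (mi_poly r) != 1%N.
  by have [] := mi_irreducible r; case: ltngtP.
have := (mi_irreducible p).2 _ sr rp.
rewrite (eqp_monic (mi_monic r) (mi_monic p)) => /eqP.
case: p {rp} => p mp ip; case: r {sr} => r mr ir /= E.
by subst r; rewrite (Prop_irrelevance mr mp) (Prop_irrelevance ir ip).
Qed.

Lemma mi_coprime (p : monic_irreducible F) P :
  ~~ (mi_poly p %| P) -> exists u, mi_poly p %| u * P - 1.
Proof.
move=> nP; have cop : coprimep P (mi_poly p).
  rewrite coprimep_sym; have [_ irr] := mi_irreducible p.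
  rewrite /coprimep; apply/negPn/negP => s1.
  have gp := irr _ s1 (dvdp_gcdl _ _).
  by move: nP; rewrite -(eqp_dvdl _ gp) dvdp_gcdr.
have [[u v] /= uv] := Bezout_eq1_coprimepP _ _ cop.
by exists u; rewrite -uv opprD addrA subrr sub0r dvdpNr dvdp_mull.
Qed.

(** Extending the residue by 0 to the functions with a pole at [c] lets it be
    applied to values of sections without carrying a proof of regularity. *)
Definition resK c k : residue_field c := residue (insubd (0 : local_ring c) k).

Lemma resKE c (l : local_ring c) : resK c (lval l) = residue l.
Proof. by congr residue; exact: valKd. Qed.

Lemma resK_lift c k : ord_ge c 0 k -> exists l : local_ring c, lval l = k.
Proof. by move=> k0; exists (@LocalRing _ c k (introT (asboolP _) k0)). Qed.

Lemma resKD c k k' : ord_ge c 0 k -> ord_ge c 0 k' ->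
  resK c (k + k') = resK c k + resK c k'.
Proof.
move=> /resK_lift[l <-] /resK_lift[l' <-].
by rewrite -[lval l + lval l']/(lval (l + l')) !resKE rmorphD.
Qed.

Lemma resKM c k k' : ord_ge c 0 k -> ord_ge c 0 k' ->
  resK c (k * k') = resK c k * resK c k'.
Proof.
move=> /resK_lift[l <-] /resK_lift[l' <-].
by rewrite -[lval l * lval l']/(lval (l * l')) !resKE rmorphM.
Qed.

Lemma resK_eq c k k' : ord_ge c 0 k -> ord_ge c 0 k' ->
  resK c k = resK c k' <-> ord_ge c 1 (k - k').
Proof.
move=> /resK_lift[l <-] /resK_lift[l' <-]; rewrite !resKE /residue.
split=> [/eqP|kk']; last apply/eqP; rewrite -Quotient.idealrBE.
  by move/asboolP.
by apply/asboolP.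
Qed.

Lemma resK0 c : resK c 0 = 0.
Proof. by rewrite -[0 in LHS]/(lval (0 : local_ring c)) resKE rmorph0. Qed.

Lemma resK1 c : resK c 1 = 1.
Proof. by rewrite -[1 in LHS]/(lval (1 : local_ring c)) resKE rmorph1. Qed.

Lemma resK_eq0 c k : ord_ge c 0 k -> resK c k = 0 <-> ord_ge c 1 k.
Proof.
by move=> k0; rewrite -(resK0 c) resK_eq ?subr0 //; exact: ord_ge0.
Qed.

Lemma resK_surj c (z : residue_field c) : exists2 k, ord_ge c 0 k & resK c k = z.
Proof.
exists (lval (repr z)); first by apply/asboolP; exact: lvalP.
by rewrite resKE /residue reprK.
Qed.

(** A denominator prime to [p] has an inverse modulo [p] that is a polynomial. *)
Lemma resK_poly_surj (p : monic_irreducible F) (z : residue_field (Finite p)) :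
  exists P, resK (Finite p) P%:K = z.
Proof.
have [k k0 <-] := resK_surj z; have [a [b [nb kE]]] := k0.
have [u /dvdpP[v uv]] := mi_coprime nb; exists (a * u).
apply/resK_eq => //; first exact: ord_ge_poly.
rewrite kE expr0z mul1r.
have -> : (a * u)%:K - a%:K / b%:K = (a * v * mi_poly p)%:K * (b%:K)^-1.
  apply: (mulIf (mi_ndvd_neq0 nb)); rewrite mulrBl !divfK ?(mi_ndvd_neq0 nb) //.
  by rewrite -tofracM -tofracB -!mulrA -uv mulrBr mulr1.
rewrite mulrC; apply: ord_geMl; first exact: ord_ge_polyV.
by apply/ord_ge1_poly; rewrite dvdp_mull.
Qed.

Lemma resK_poly_eq (p : monic_irreducible F) P Q :
  resK (Finite p) P%:K = resK (Finite p) Q%:K <-> mi_poly p %| P - Q.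
Proof.
by rewrite resK_eq -?tofracB ?ord_ge1_poly //; exact: ord_ge_poly.
Qed.

(** A polynomial prime to [p] is invertible modulo [p]. *)
Lemma ord_ge1_cancel (p : monic_irreducible F) P k : ~~ (mi_poly p %| P) ->
  ord_ge (Finite p) 0 k -> ord_ge (Finite p) 1 (P%:K * k) ->
  ord_ge (Finite p) 1 k.
Proof.
move=> /mi_coprime[u uP] k0 Pk.
have -> : k = u%:K * (P%:K * k) - k * (u * P - 1)%:K.
  rewrite tofracB tofracM tofrac1 mulrBr mulr1 mulrA [k * _]mulrC.
  by rewrite opprB addrC subrK.
apply: ord_geB; first by apply: ord_geMl => //; exact: ord_ge_poly.
by apply: ord_geMl => //; apply/ord_ge1_poly.
Qed.

Lemma ord_ge1_mod (p : monic_irreducible F) P k : mi_poly p %| P ->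
  ord_ge (Finite p) 0 k -> ord_ge (Finite p) 1 (P%:K * k).
Proof.
by move=> pP k0; rewrite mulrC; apply: ord_geMl => //; apply/ord_ge1_poly.
Qed.

End Orders.

(** * Line bundles on the projective line *)

Section LineBundles.
Variable F : fieldType.
Notation K := {fraction {poly F}}.
Notation OP1 := (structure_sheaf F).
Implicit Types (c : closed_point F) (P Q : {poly F}) (k : K) (m n : int).
Implicit Types (U V W : opens (P1 F)).

Lemma ord_ge_expz c (e m : int) k :
  ord_ge c e k -> ord_ge c (- e) k^-1 -> ord_ge c (e * m) (k ^ m).
Proof.
have aux (e' : int) k' (j : nat) :
    ord_ge c e' k' -> ord_ge c (e' * j%:Z) (k' ^+ j).
  move=> k'e; elim: j => [|j IH]; first by rewrite expr0 mulr0; exact: ord_ge1.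
  by rewrite exprS -addn1 PoszD mulrDr mulr1 addrC; exact: ord_geM.
move=> ke kVe; case: m => j; first exact: aux.
by rewrite NegzE -exprnN -exprVn mulrN -mulNr; exact: aux.
Qed.

Lemma polyX_irreducible : irreducible_poly ('X : {poly F}).
Proof.
by have := @irredp_XsubC F 0; rewrite subr0.
Qed.

Definition originP := MonicIrreducible (monicX F) polyX_irreducible.
Definition origin : closed_point F := Finite originP.

Lemma punctured_open c : open (~` [set Closed c] : set (P1 F)).
Proof. by right; split => //; rewrite setCK; exact: finite_set1. Qed.

Definition punctured c : opens (P1 F) := Opens (punctured_open c).

Lemma punctured_neq c c' : open_set (punctured c) (Closed c') -> c' <> c.
Proof. by move=> h cc'; apply: h; rewrite /= cc'. Qed.

Lemma ord_ge_Xz_infty m : ord_ge (Infinity F) (- m) ('X%:K ^ m).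
Proof.
rewrite -mulN1r; apply: ord_ge_expz.
  by apply: ord_ge_infty_poly; rewrite size_polyX.
by rewrite opprK; apply: ord_ge_infty_polyV; rewrite ?polyX_eq0 ?size_polyX.
Qed.

Lemma ord_ge_Xz c m : c <> origin -> c <> Infinity F -> ord_ge c 0 ('X%:K ^ m).
Proof.
case: c => // p po _; rewrite -(mul0r m); apply: ord_ge_expz.
  exact: ord_ge_poly.
rewrite oppr0; apply: ord_ge_polyV; apply/negP => pX; apply: po.
by congr Finite; exact: mi_dvd_mi.
Qed.

Lemma twist_finite n (p : monic_irreducible F) : twist n (Finite p) = 0.
Proof. by []. Qed.

Lemma twist_infty n : twist n (Infinity F) = n.
Proof. by []. Qed.

(** The rational section [k] generates O(n) at every closed point of [U]. *)
Definition trivializes (n : int) (U : set (P1 F)) (k : K) :=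
  k != 0 /\ forall c, U (Closed c) ->
    ord_ge c (- twist n c) k /\ ord_ge c (twist n c) k^-1.

Lemma trivializes_finite n : trivializes n (punctured (Infinity F)) 1.
Proof.
split=> [|c cU]; first exact: oner_neq0.
rewrite invr1; case: c cU => [p _|/punctured_neq//].
rewrite twist_finite oppr0.
by split; exact: ord_ge1.
Qed.

Lemma trivializes_infty n : trivializes n (punctured origin) ('X%:K ^ n).
Proof.
split=> [|c /punctured_neq co].
  by apply: expfz_neq0; rewrite tofrac_eq0 polyX_eq0.
rewrite invr_expz; case: c co => [p co|_].
  by rewrite twist_finite oppr0; split; exact: ord_ge_Xz.
rewrite twist_infty; split; first exact: ord_ge_Xz_infty.
by rewrite -[n in ord_ge _ n _]opprK; exact: ord_ge_Xz_infty.
Qed.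

(** O(n) is generated by 1 away from infinity and by 'X^n away from the origin. *)
Lemma trivialize (y : P1 F) : exists U, open_set U y /\
  forall n, exists k, trivializes n U k.
Proof.
have [->|yinf] := pselect (y = Closed (Infinity F)).
  exists (punctured origin); split => [[]//|n].
  by exists ('X%:K ^ n); exact: trivializes_infty.
by exists (punctured (Infinity F)); split => // n; exists 1;
  exact: trivializes_finite.
Qed.

Lemma mul_section_subproof m n U k (s : points U -> K) :
  (forall c, open_set U (Closed c) -> ord_ge c (twist m c - twist n c) k) ->
  s \in @section_pred F m U -> (fun y => k * s y) \in @section_pred F n U.
Proof.
move=> kP /asboolP[s1 s2]; apply/asboolP.
split => [y z|]; first by rewrite (s1 y z).
case=> -[|c] Uc //=; have /= sc := s2 (exist _ _ Uc).
rewrite (_ : - twist n c = (twist m c - twist n c) + - twist m c); last first.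
  by rewrite addrC addKr.
by apply: ord_geM => //; exact: kP.
Qed.

Lemma twist0 c : twist 0 c = 0.
Proof. by case: c. Qed.

Definition mul_section m n U k
    (kP : forall c, open_set U (Closed c) -> ord_ge c (twist m c - twist n c) k)
    (s : twist_section m U) : twist_section n U :=
  TwistSection (mul_section_subproof kP (tsvalP s)).

Lemma twist_section_eq n U (s t : twist_section n U) :
  (forall y, tsval s y = tsval t y) -> s = t.
Proof. by move=> st; apply: val_inj; apply/funext. Qed.

Lemma structure_section_eq U (s t : structure_section U) :
  (forall y, osval s y = osval t y) -> s = t.
Proof. by move=> st; apply: val_inj; apply/funext. Qed.

Lemma self_module_O0 : isomorphic (self_module OP1) (O_ 0).
Proof.
pose f U (s : structure_section U) : twist_section 0 U := TwistSection (osvalP s).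
pose g U (s : twist_section 0 U) : structure_section U :=
  StructureSection (tsvalP s).
unshelve eexists (@make_omor _ _ (self_module OP1) (O_ 0) f _ _);
  last unshelve eexists (@make_omor _ _ (O_ 0) (self_module OP1) g _ _).
- by move=> U a s t; exact: twist_section_eq.
- by move=> U V VU s; exact: twist_section_eq.
- by move=> U a s t; exact: structure_section_eq.
- by move=> U V VU s; exact: structure_section_eq.
by move=> U; split => s; [exact: structure_section_eq | exact: twist_section_eq].
Qed.

Lemma locally_free_dsum_O m n : locally_free 2 (dsum (O_ m) (@O_ F n)).
Proof.
move=> y; have [U [Uy triv]] := trivialize y; exists U; split => //.
have /cid[km kmP] := triv m; have /cid[kn knP] := triv n.
have mulP (j : int) k V : V `<=` U -> trivializes j U k ->
    forall c, open_set V (Closed c) -> ord_ge c (twist 0 c - twist j c) k.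
  by move=> VU [_ kP] c /VU /kP[]; rewrite twist0 sub0r.
have divP (j : int) k V : V `<=` U -> trivializes j U k ->
    forall c, open_set V (Closed c) -> ord_ge c (twist j c - twist 0 c) k^-1.
  by move=> VU [_ kP] c /VU /kP[]; rewrite twist0 subr0.
pose phi V (VU : V `<=` U) (v : 'rV[structure_section V]_2) :
    (twist_section m V * twist_section n V)%type :=
  (TwistSection (mul_section_subproof (mulP m km V VU kmP) (osvalP (v 0 0))),
   TwistSection (mul_section_subproof (mulP n kn V VU knP) (osvalP (v 0 1)))).
have lin V (VU : V `<=` U) :
    linear (phi V VU : 'rV[OP1 V]_2 -> dsum (O_ m) (O_ n) V).
  move=> a s t; congr pair; apply: twist_section_eq => z /=;
  by rewrite !mxE /= mulrDr mulrCA.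
pose psi V (VU : V `<=` U) : {linear 'rV[OP1 V]_2 -> dsum (O_ m) (O_ n) V} :=
  HB.pack (phi V VU : 'rV[OP1 V]_2 -> dsum (O_ m) (O_ n) V)
    (GRing.isLinear.Build _ _ _ _ _ (lin V VU)).
exists psi; split=> [V VU|V W VU WU WV v].
  exists (fun s : (twist_section m V * twist_section n V)%type =>
    \row_j if j == 0 then
      StructureSection (mul_section_subproof (divP m km V VU kmP) (tsvalP s.1))
    else
      StructureSection (mul_section_subproof (divP n kn V VU knP) (tsvalP s.2))).
    move=> v; apply/rowP => j; rewrite mxE /=.
    have [->|j1] := eqVneq j 0; apply: (@structure_section_eq V) => z /=.
      by rewrite mulKf // kmP.1.
    have -> : j = 1 by apply: val_inj; case: j j1 => [[|[|]]].
    by rewrite mulKf // knP.1.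
  move=> [s t]; congr pair; apply: twist_section_eq => z; rewrite /= mxE /=.
    by rewrite mulVKf // kmP.1.
  by rewrite mulVKf // knP.1.
by congr pair; apply: twist_section_eq => z; rewrite /= mxE.
Qed.

Lemma locally_free_dsum_self :
  locally_free 2 (dsum (self_module OP1) (self_module OP1)).
Proof.
apply: locally_free_iso (locally_free_dsum_O 0 0).
by apply: isomorphic_dsum; apply: isomorphic_sym; exact: self_module_O0.
Qed.

End LineBundles.

(** * Morphisms between line bundles *)

Section Homs.
Variable F : fieldType.
Notation K := {fraction {poly F}}.
Notation OP1 := (structure_sheaf F).
Implicit Types (c : closed_point F) (P Q : {poly F}) (k : K) (m n : int).
Implicit Types (U V W : opens (P1 F)).

Lemma monic_irreducible_factor Q : (1 < size Q)%N ->
  exists p : monic_irreducible F, mi_poly p %| Q.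
Proof.
have [s] := ubnP (size Q); elim: s Q => // s IH Q sQ Q1.
have [irr|] := pselect (irreducible_poly Q).
  have Q0 : lead_coef Q != 0 by rewrite lead_coef_eq0 -size_poly_gt0; lia.
  pose P := (lead_coef Q)^-1 *: Q.
  have PQ : P %= Q by apply: eqp_scale; rewrite invr_eq0.
  have Pm : P \is monic by rewrite monicE lead_coefZ mulVf.
  have Pirr : irreducible_poly P.
    split=> [|d d1 dP]; first by rewrite (eqp_size PQ).
    apply: eqp_trans (irr.2 d d1 _) _; last by rewrite eqp_sym.
    by rewrite -(eqp_dvdr _ PQ).
  by exists (MonicIrreducible Pm Pirr); rewrite /= (eqp_dvdl _ PQ).
move=> nirr; have [d [d1 dQ ndQ]] : exists d : {poly F},
    [/\ size d != 1%N, d %| Q & ~~ (d %= Q)].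
  apply: contrapT => no; apply: nirr; split=> // d d1 dQ.
  by apply/negPn/negP => ndQ; apply: no; exists d.
have Qn0 : Q != 0 by rewrite -size_poly_gt0; lia.
have d0 : d != 0 by apply: contraNneq Qn0 => d0; rewrite -dvd0p -d0.
have [||p pd] := IH d.
- apply: (@leq_trans (size Q)); last by rewrite -ltnS.
  by rewrite ltn_neqAle dvdp_size_eqp // ndQ dvdp_leq.
- by move: d1; rewrite -size_poly_gt0 in d0; case: (size d) d0 => [|[]].
by exists p; exact: dvdp_trans pd dQ.
Qed.

Lemma cross_mul (R : fieldType) (a b e d : R) :
  b != 0 -> d != 0 -> a / b = e / d -> a * d = e * b.
Proof. by move=> b0 d0 abed; apply/eqP; rewrite -eqr_div // abed. Qed.

(** Regularity at an irreducible factor of the denominator allows cancelling it,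
    so [k] is a polynomial, and a polynomial that vanishes at infinity is 0. *)
Lemma regular_vanishing k :
  (forall c, ord_ge c 0 k) -> ord_ge (Infinity F) 1 k -> k = 0.
Proof.
move=> reg [a [b [b0 kE sab]]].
have [s] := ubnP (size b); elim: s a b b0 kE sab => // s IH a b b0 kE sab sb.
have bK : b%:K != 0 by rewrite tofrac_eq0.
have b1 := b0; rewrite -size_poly_gt0 in b1.
have [b_small|/monic_irreducible_factor[p pb]] := leqP (size b) 1.
  have : size a = 0%N by lia.
  by move/eqP; rewrite size_poly_eq0 => /eqP a0; rewrite kE a0 tofrac0 mul0r.
have [e [d [nd ed]]] := reg (Finite p); rewrite expr0z mul1r kE in ed.
have dK := mi_ndvd_neq0 nd.
have {ed} ed : a * d = e * b.
  apply/eqP; rewrite -tofrac_eq; apply/eqP; rewrite !tofracM.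
  by refine (@cross_mul _ a%:K b%:K e%:K d%:K bK dK _).
have pa : mi_poly p %| a.
  apply: contraTT isT => na.
  by have := mi_ndvdM na nd; rewrite ed dvdp_mull.
have /dvdpP[a' aE] := pa; have /dvdpP[b' bE] := pb.
have p0 := mi_neq0 p; have := p0; rewrite tofrac_eq0 => p0'.
have b'0 : b' != 0 by apply: contraNneq b0 => b'0; rewrite bE b'0 mul0r.
have sp : (1 < size (mi_poly p))%N by case: (mi_irreducible p).
have sbE : size b = (size b' + size (mi_poly p)).-1 by rewrite bE size_mul.
apply: (IH a' b') => //.
- by rewrite kE aE bE !tofracM -mulf_div divff // mulr1.
- have [a'0|a'0] := eqVneq a' 0.
    by rewrite a'0 size_poly0; rewrite -size_poly_gt0 in b'0; lia.
  have saE : size a = (size a' + size (mi_poly p)).-1 by rewrite aE size_mul.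
  rewrite -size_poly_gt0 in a'0; rewrite -size_poly_gt0 in b'0.
  move: sab saE sbE sp a'0 b'0.
  move: (size a) (size b) (size a') (size b') (size (mi_poly p)) => *; lia.
rewrite -size_poly_gt0 in b'0; move: sb sbE sp b'0.
by move: (size b) (size b') (size (mi_poly p)) => *; lia.
Qed.

Lemma const_section_subproof n U k :
  (forall c, open_set U (Closed c) -> ord_ge c (- twist n c) k) ->
  (fun=> k) \in @section_pred F n U.
Proof. by move=> kP; apply/asboolP; split => // -[[|c] Uc] //=; exact: kP. Qed.

Definition const_section n U k
    (kP : forall c, open_set U (Closed c) -> ord_ge c (- twist n c) k) :
    twist_section n U :=
  TwistSection (const_section_subproof kP).

Lemma trivializes_section n U k : trivializes n (open_set U) k ->
  forall c, open_set U (Closed c) -> ord_ge c (- twist n c) k.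
Proof. by move=> [_ kP] c /kP[]. Qed.

Definition unit_section n : twist_section n (punctured (Infinity F)) :=
  const_section (trivializes_section (trivializes_finite F n)).

Lemma unit_section_neq0 n : unit_section n <> 0.
Proof.
move/(congr1 (@tsval F n _)) => E.
have gen : open_set (punctured (Infinity F)) (Generic F) by [].
have := congr1 (fun f => f (exist _ _ gen)) E.
by apply/eqP; exact: oner_neq0.
Qed.

(** Let [k] be the image of the generator 1 of O(m) away from infinity and [l]
    that of the generator 'X^m away from the origin.  On the overlap
    [l = 'X^m * k], so [k] is regular at the finite points and vanishes to order
    at least [m - n > 0] at infinity. *)
Lemma omor_O_zero m n (f : omor (O_ m) (@O_ F n)) : n < m ->
  f (punctured (Infinity F)) (unit_section m) = 0.
Proof.
move=> nm; set A := punctured _; set s := f A _.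
pose B : opens (P1 F) := punctured (origin F).
have oW : open (open_set A `&` open_set B) by apply: openI; exact: open_setP.
pose W := Opens oW.
have WA : W `<=` A by move=> y [].
have WB : W `<=` B by move=> y [].
pose u : twist_section m B :=
  const_section (trivializes_section (trivializes_infty F m)).
pose t : twist_section n B := f B u.
have XW : forall c, open_set W (Closed c) -> ord_ge c (- twist 0 c) ('X%:K ^ m).
  move=> c [/punctured_neq cinf /punctured_neq c0]; rewrite twist0 oppr0.
  exact: ord_ge_Xz.
pose x : structure_section W := StructureSection (const_section_subproof XW).
have st : twist_res WB t = x *: twist_res WA (s : twist_section n A) :> O_ n W.
  rewrite -[LHS]/(mres WB (f B u)).
  rewrite -[twist_res WA _]/(mres WA (f A (unit_section m))).
  rewrite -!omap_res -linearZ; congr (f W _).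
  by apply: twist_section_eq => y /=; rewrite mulr1.
have gA : open_set A (Generic F) by [].
have gB : open_set B (Generic F) by [].
pose k := tsval s (exist _ _ gA); pose l := tsval t (exist _ _ gB).
have lk : l = 'X%:K ^ m * k.
  have : tsval t (exist _ _ (WB _ (conj gA gB))) =
      'X%:K ^ m * tsval s (exist _ _ (WA _ (conj gA gB))).
    pose at_gen (h : twist_section n W) := tsval h (exist _ _ (conj gA gB)).
    exact: (congr1 at_gen st).
  by rewrite (Prop_irrelevance (WB _ _) gB) (Prop_irrelevance (WA _ _) gA).
have /asboolP[s1 s2] := tsvalP s; have /asboolP[t1 t2] := tsvalP t.
have Xm0 : ('X%:K : K) ^ m != 0.
  by apply: expfz_neq0; rewrite tofrac_eq0 polyX_eq0.
have kl : k = 'X%:K ^ (- m) * l by rewrite lk -invr_expz mulKf.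
have kinf : ord_ge (Infinity F) (m - n) k.
  rewrite kl -{1}[m]opprK; apply: ord_geM; first exact: ord_ge_Xz_infty.
  have Binf : open_set B (Closed (Infinity F)) by [].
  by have /= := t2 (exist _ _ Binf); rewrite (t1 _ (exist _ _ gB)).
have k0 : k = 0.
  apply: regular_vanishing; last by apply: ord_ge_mono kinf; lia.
  case=> [p|]; last by apply: ord_ge_mono kinf; lia.
  have Ap : open_set A (Closed (Finite p)) by [].
  have := s2 (exist _ _ Ap); rewrite (s1 _ (exist _ _ gA)) /twist_stalk /=.
  by rewrite oppr0.
by apply: twist_section_eq => y; rewrite (s1 y (exist _ _ gA)).
Qed.

(** The components of an isomorphism kill the summand O(m), hence its nonzero
    section 1 over the complement of infinity. *)
Lemma not_isomorphic_dsum_O m m' n n' : n < m -> n' < m ->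
  ~ isomorphic (dsum (O_ m') (O_ m)) (dsum (O_ n) (@O_ F n')).
Proof.
move=> nm n'm [f [g fg]].
have inr U V (VU : V `<=` U) (s : twist_section m U) :
    ((0, twist_res VU s) : dsum (O_ m') (O_ m) V) =
    mres VU ((0, s) : dsum (O_ m') (O_ m) U).
  by congr pair; rewrite /= raddf0.
have inrlin U a (s t : O_ m U) : ((0, a *: s + t) : dsum (O_ m') (O_ m) U) =
    a *: ((0, s) : dsum (O_ m') (O_ m) U) + ((0, t) : dsum (O_ m') (O_ m) U).
  by congr pair; rewrite /= scaler0 addr0.
pose f1 U (s : O_ m U) : O_ n U := (f U ((0, s) : dsum (O_ m') (O_ m) U)).1.
pose f2 U (s : O_ m U) : O_ n' U := (f U ((0, s) : dsum (O_ m') (O_ m) U)).2.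
have lin1 U : linear (f1 U) by move=> a s t; rewrite /f1 inrlin linearP.
have lin2 U : linear (f2 U) by move=> a s t; rewrite /f2 inrlin linearP.
have res1 U V (VU : V `<=` U) s : f1 V (mres VU s) = mres VU (f1 U s).
  by rewrite /f1 (inr U V VU s) omap_res.
have res2 U V (VU : V `<=` U) s : f2 V (mres VU s) = mres VU (f2 U s).
  by rewrite /f2 (inr U V VU s) omap_res.
have z1 := omor_O_zero (make_omor lin1 res1) nm.
have z2 := omor_O_zero (make_omor lin2 res2) n'm.
apply: (@unit_section_neq0 m).
set A := punctured _ in z1 z2 *.
have : f A ((0, unit_section m) : dsum (O_ m') (O_ m) A) = 0.
  by rewrite [LHS]surjective_pairing; congr pair.
have [fK _] := fg A => /(congr1 (g A)); rewrite fK raddf0.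
by move/(congr1 snd).
Qed.

End Homs.

(** * Quotients of the trivial plane bundle supported at one point *)

Lemma proportional (R : comNzRingType) (a b a' b' : R) :
  (forall z : R, z != 0 -> exists w, w * z = 1) ->
  (a != 0) || (b != 0) -> (a' != 0) || (b' != 0) -> a * b' = a' * b ->
  exists l m, [/\ l * m = 1, a' = l * a & b' = l * b].
Proof.
move=> inv; wlog a0 : a b a' b' / a != 0 => [wl ab|_].
  have [b0|b0] := eqVneq b 0; last first.
    move=> a'b' E; have [|||l [m [lm b'E a'E]]] := wl b a b' a' b0.
    - by rewrite b0.
    - by rewrite orbC.
    - by rewrite mulrC -E mulrC.
    by exists l, m.
  have a0 : a != 0 by move: ab; rewrite b0 eqxx orbF.
  exact: wl.
move=> a'b' E; have [w wa] := inv _ a0.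
have b'E : b' = a' * w * b by rewrite mulrAC -E mulrC mulrA wa mul1r.
have a'E : a' = a' * w * a by rewrite -mulrA wa mulr1.
have /inv[m ml] : a' * w != 0.
  by apply: contraTneq a'b' => l0; rewrite b'E a'E l0 !mul0r eqxx.
by exists (a' * w), m; rewrite mulrC.
Qed.

Section Quotients.
Variables (F : fieldType) (p : monic_irreducible F).
Notation K := {fraction {poly F}}.
Notation OP1 := (structure_sheaf F).
Notation x := (Finite p).
Notation OX := (self_module OP1).
Notation OO := (dsum OX OX).
Notation Qx := (skyscraper x).
Implicit Types (A B P Q : {poly F}) (k : K) (U V W : opens (P1 F)).

Lemma value_atE c U (Uc : open_set U (Closed c)) (a : structure_section U) :
  value_at Uc a = resK c (osval a (exist _ _ Uc)).
Proof. by rewrite /value_at -resKE. Qed.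

Lemma structure_section_ord c U (Uc : open_set U (Closed c))
    (a : structure_section U) :
  ord_ge c 0 (osval a (exist _ _ Uc)).
Proof.
have /asboolP[_ /(_ (exist _ _ Uc))] := osvalP a.
by rewrite /twist_stalk /= twist0 oppr0.
Qed.

Lemma poly_section_subproof U : ~ open_set U (Closed (Infinity F)) ->
  forall P c, open_set U (Closed c) -> ord_ge c (- twist 0 c) P%:K.
Proof. by move=> Uinf P [r|//] _; rewrite twist0 oppr0; exact: ord_ge_poly. Qed.

Definition poly_section U (Uinf : ~ open_set U (Closed (Infinity F))) P :
    structure_section U :=
  StructureSection (const_section_subproof (poly_section_subproof Uinf P)).

(** The surjection sends (1, 0) and (0, 1) to the residues of [A] and [B]. *)
Definition represents (t : ses OO Qx) (A B : {poly F}) :=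
  forall U (Ux : open_set U (Closed x)) (a b : structure_section U),
    (ses_proj t U ((a, b) : OO U) : sky_section x U) Ux =
      resK x A%:K * resK x (osval a (exist _ _ Ux)) +
      resK x B%:K * resK x (osval b (exist _ _ Ux)).

(** [A] and [B] are homogeneous coordinates of a point [[A : B]] of the projective
    line over the residue field. *)
Definition projective (A B : {poly F}) :=
  ~~ ((mi_poly p %| A) && (mi_poly p %| B)).

Definition whole : opens (P1 F) := Opens (@openT (P1 F)).

Lemma represents_exist t : exists A B, represents t A B.
Proof.
have Tx : open_set whole (Closed x) by [].
pose S := structure_section whole.
pose e1 : OO whole := ((1, 0) : S * S)%type.
pose e2 : OO whole := ((0, 1) : S * S)%type.
pose g U (s : OO U) : sky_section x U := ses_proj t U s.
have [A AE] := resK_poly_surj (g whole e1 Tx).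
have [B BE] := resK_poly_surj (g whole e2 Tx).
exists A, B => U Ux a b.
have UT : U `<=` whole by [].
have -> : ((a, b) : OO U) = (a : OP1 U) *: mres UT e1 + (b : OP1 U) *: mres UT e2.
  by congr pair; apply: structure_section_eq => y /=;
    rewrite /= !fctE ?mulr1 ?mulr0 ?addr0 ?add0r.
rewrite linearD !linearZ /= !omap_res AE BE -!value_atE.
rewrite -(Prop_irrelevance (UT _ Ux) Tx) ![g whole _ _ * _]mulrC.
by [].
Qed.

Lemma represents_projective t A B : represents t A B -> projective A B.
Proof.
move=> tAB; apply/negP => /andP[pA pB].
have [_ _ surj] := ses_exact t.
have Tx : open_set whole (Closed x) by [].
have [V [VT [Vx [[a b] E]]]] := surj whole ((fun=> 1) : sky_section x whole) _ Tx.
have := congr1 (fun f : sky_section x V => f Vx) E.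
have /(resK_poly_eq p A 0).2 : mi_poly p %| A - 0 by rewrite subr0.
have /(resK_poly_eq p B 0).2 : mi_poly p %| B - 0 by rewrite subr0.
rewrite tofrac0 resK0 => B0 A0; rewrite (tAB V Vx) A0 B0 !mul0r addr0.
by move/esym/eqP; rewrite -[_ == _]/(1 == 0 :> residue_field x) oner_eq0.
Qed.

Lemma residue_inv (z : residue_field x) : z != 0 -> exists w, w * z = 1.
Proof.
have [P <-] := resK_poly_surj z => P0.
have nP : ~~ (mi_poly p %| P).
  apply: contra P0 => pP; apply/eqP; rewrite -(resK0 x) -tofrac0.
  by apply/resK_poly_eq; rewrite subr0.
have [u uP] := mi_coprime nP; exists (resK x u%:K).
rewrite -resKM -?tofracM; try exact: ord_ge_poly.
by rewrite -(resK1 x) -tofrac1; apply/resK_poly_eq.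
Qed.

Lemma resK_poly_eq0 P : (resK x P%:K == 0) = (mi_poly p %| P).
Proof.
apply/eqP/idP => [|pP].
  by rewrite -(resK0 x) -tofrac0 resK_poly_eq subr0.
by rewrite -(resK0 x) -tofrac0; apply/resK_poly_eq; rewrite subr0.
Qed.

Definition sky_mul (l : residue_field x) U (s : sky_section x U) :
    sky_section x U :=
  fun Ux => l * s Ux.

Lemma sky_mul_linear l U : linear (@sky_mul l U : Qx U -> Qx U).
Proof.
move=> a s t; apply/funext => Ux; rewrite /sky_mul.
rewrite -[LHS]/(l * (value_at Ux a * s Ux + t Ux)).
by rewrite mulrDr mulrCA.
Qed.

Definition sky_scaling l : omor Qx Qx :=
  @make_omor _ _ Qx Qx (@sky_mul l) (sky_mul_linear l) (fun U V VU s => erefl).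

(** An isomorphism preserves the kernel, and the kernel contains the section
    [(B, - A)] over the complement of infinity, which pins down [[A : B]].
    Conversely, if the coordinates are proportional, multiplication by the ratio
    identifies the two surjections, and their kernels follow. *)
Lemma represents_iso t t' A B A' B' : represents t A B -> represents t' A' B' ->
  ses_iso t t' <-> mi_poly p %| A * B' - A' * B.
Proof.
move=> tAB tAB'; split=> [tt'|].
  set U := punctured (Infinity F).
  have Ux : open_set U (Closed x) by [].
  have Uinf : ~ open_set U (Closed (Infinity F)) by move/punctured_neq.
  pose poly := poly_section Uinf.
  have := @ses_iso_kernel _ _ _ _ _ _ U ((poly B, poly (- A)) : OO U) tt'.
  have E (u : ses OO Qx) C D : represents u C D ->
      (ses_proj u U ((poly B, poly (- A)) : OO U) : sky_section x U) Ux =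
      resK x (C * B - D * A)%:K.
    move=> uCD; rewrite uCD /= -!resKM; try exact: ord_ge_poly.
    rewrite -resKD -?tofracM -?tofracD ?mulrN //; exact: ord_ge_poly.
  have kt : ses_proj t U ((poly B, poly (- A)) : OO U) = 0.
    apply/funext => Ux'; rewrite (Prop_irrelevance Ux' Ux) (E _ _ _ tAB).
    by rewrite mulrC subrr tofrac0 resK0.
  move/(_ kt)/(congr1 (fun f : sky_section x U => f Ux)).
  rewrite (E _ _ _ tAB') -[RHS]/(0 : residue_field x) -(resK0 x) -tofrac0.
  by rewrite resK_poly_eq subr0 -dvdpNr opprB [B' * A]mulrC.
move=> ABdet.
have nz u C D : represents u C D -> (resK x C%:K != 0) || (resK x D%:K != 0).
  move/represents_projective; rewrite /projective.
  by rewrite negb_and -(resK_poly_eq0 C) -(resK_poly_eq0 D).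
have det : resK x A%:K * resK x B'%:K = resK x A'%:K * resK x B%:K.
  rewrite -(resKM (ord_ge_poly p A) (ord_ge_poly p B')).
  rewrite -(resKM (ord_ge_poly p A') (ord_ge_poly p B)) -!tofracM.
  exact/resK_poly_eq.
have [l [m [lm AE BE]]] :=
  proportional residue_inv (nz _ _ _ tAB) (nz _ _ _ tAB') det.
have tt' U s : ses_proj t' U s = sky_mul l (ses_proj t U s : sky_section x U).
  case: s => a b; apply/funext => Ux.
  by rewrite /sky_mul tAB tAB' AE BE mulrDr !mulrA.
have ml : m * l = 1 by rewrite mulrC.
have mK (a b : residue_field x) U : a * b = 1 ->
    cancel (@sky_mul a U) (@sky_mul b U).
  by move=> ab s; apply/funext => Ux; rewrite /sky_mul mulrA [b * a]mulrC ab mul1r.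
have same U s : ses_proj t U s = 0 <-> ses_proj t' U s = 0.
  rewrite tt'; split=> [->|E]; first by apply/funext => Ux; rewrite /sky_mul mulr0.
  rewrite -[LHS](mK l m U lm) E; apply/funext => Ux; exact: mulr0.
have [h [h' [hh' hE]]] := same_kernel_iso (ses_exact t) (ses_exact t') same.
exists h, h', (sky_scaling l), (sky_scaling m); split=> //.
by move=> U; split; exact: mK.
Qed.

Lemma projective_ord A B k : projective A B -> ord_ge x 0 k ->
  ord_ge x 1 (A%:K * k) -> ord_ge x 1 (B%:K * k) -> ord_ge x 1 k.
Proof.
rewrite /projective negb_and => AB k0 Ak Bk; have [nA|nB] := orP AB.
  exact: ord_ge1_cancel nA k0 Ak.
exact: ord_ge1_cancel nB k0 Bk.
Qed.

End Quotients.

(** * The kernel of a surjection has a reduced basis *)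

(** Say that [f] has degree [d].  Reducing a solution [u] modulo [f] makes its
    degree less than [d]; then [P - g * u] has degree at most [N], because
    [2 * d <= N], and its quotient by [f] has degree at most [N - d]. *)
Lemma bezout_bounded (F : fieldType) (f g P : {poly F}) (d N : nat) :
  coprimep f g -> maxn (size f) (size g) = d.+1 -> (d.*2 <= N)%N ->
  (size P <= N.+1)%N ->
  exists u w, [/\ g * u + f * w = P, (size u <= (N - d).+1)%N
                & (size w <= (N - d).+1)%N].
Proof.
wlog gf : f g / (size g <= size f)%N => [wl cop|].
  move=> fg dN PN; have [gf|/ltnW fg'] := leqP (size g) (size f).
    exact: (wl f g).
  have [||u [w [E su sw]]] := wl g f fg' _ _ dN PN.
  - by rewrite coprimep_sym.
  - by rewrite maxnC.
  by exists w, u; rewrite addrC.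
move=> /Bezout_eq1_coprimepP[[a b] /= ab]; rewrite (maxn_idPl gf) => sf dN PN.
have f0 : f != 0 by rewrite -size_poly_gt0 sf.
pose u : {poly F} := (b * P) %% f.
have su : (size u <= d)%N by rewrite -ltnS -sf ltn_modp.
have fPu : f %| P - g * u.
  have -> : P - g * u = (a * P + g * ((b * P) %/ f)) * f.
    have bP : u = b * P - (b * P) %/ f * f.
      by rewrite {1}(divp_eq (b * P) f) addrC addKr.
    have P1 : P = (a * f + b * g) * P by rewrite ab mul1r.
    rewrite bP {1}P1; ring.
  exact: dvdp_mull.
clearbody u; exists u, ((P - g * u) %/ f); split.
- by rewrite [f * _]mulrC divpK // addrC subrK.
- by apply: leq_trans su _; move: dN; rewrite -addnn; clear; lia.
have gu : (size (g * u)%R <= d + d)%N.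
  apply: leq_trans (size_polyMleq _ _) _; move: gf su; rewrite sf; lia.
have arith (n k l : nat) : (n <= maxn k l)%N -> (l <= d + d)%N -> (k <= N.+1)%N ->
    (d.*2 <= N)%N -> (n - d <= (N - d).+1)%N by lia.
rewrite size_divp // sf /=; apply: (arith _ _ _ _ gu PN dN).
by apply: leq_trans (size_polyD _ _) _; rewrite size_polyN.
Qed.

Lemma quadratic_collect (R : comPzRingType) (v l m a b a' b' : R) :
  l * (v * a + a') + m * (v * b + b') = v * (l * a + m * b) + (l * a' + m * b').
Proof. ring. Qed.

Lemma cramer2 (R : fieldType) (f g u w P s1 s2 a b : R) :
  g * u + f * w = P -> P != 0 ->
  a = g * s1 + w * s2 -> b = u * s2 - f * s1 ->
  s1 = P^-1 * (u * a - w * b) /\ s2 = P^-1 * (f * a + g * b).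
Proof.
move=> E P0 -> ->; split; apply: (mulfI P0); rewrite mulVKf // -E; ring.
Qed.

Lemma cramer2V (R : fieldType) (f g u w P a b : R) :
  g * u + f * w = P -> P != 0 ->
  g * (P^-1 * (u * a - w * b)) + w * (P^-1 * (f * a + g * b)) = a /\
  u * (P^-1 * (f * a + g * b)) - f * (P^-1 * (u * a - w * b)) = b.
Proof.
by move=> E P0; split; apply: (mulfI P0); rewrite -E; field; rewrite E.
Qed.

Section ReducedBasis.
Variables (F : fieldType) (p : monic_irreducible F).
Notation K := {fraction {poly F}}.
Notation OP1 := (structure_sheaf F).
Notation x := (Finite p).
Notation OX := (self_module OP1).
Notation OO := (dsum OX OX).
Notation Qx := (skyscraper x).
Implicit Types (P Q : {poly F}) (k : K) (U V W : opens (P1 F)).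

(** Modulo [p] the points [[A : B]] and [[f : g]] coincide, so that [(g, - f)] and
    [(w, u)] are sections of the kernel.  Their determinant is [p]; its degree
    [d + e] is the sum of the degrees [d] and [e] allowed for the two sections,
    which makes them a basis at infinity as well. *)
Variables (A B f g u w : {poly F}) (d e : nat).
Hypothesis AB : projective p A B.
Hypothesis fg : projective p f g.
Hypothesis ABfg : mi_poly p %| A * g - B * f.
Hypothesis det : g * u + f * w = mi_poly p.
Hypothesis sp : size (mi_poly p) = (d + e).+1.
Hypothesis sf : (size f <= d.+1)%N.
Hypothesis sg : (size g <= d.+1)%N.
Hypothesis su : (size u <= e.+1)%N.
Hypothesis sw : (size w <= e.+1)%N.

Lemma poly_twist P (j : nat) c : (size P <= j.+1)%N ->
  ord_ge c (twist (- j%:Z) c - twist 0 c) P%:K.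
Proof.
rewrite twist0 subr0; case: c => [r|] sP; first exact: ord_ge_poly.
by rewrite twist_infty; apply: ord_ge_infty_poly; lia.
Qed.

Section Map.
Variable U : opens (P1 F).

Definition poly_mul P (j : nat) (sP : (size P <= j.+1)%N)
    (s : twist_section (- j%:Z) U) : twist_section 0 U :=
  mul_section (fun c _ => poly_twist c sP) s.

Definition basis_map (s : twist_section (- e%:Z) U * twist_section (- d%:Z) U) :
    structure_section U * structure_section U :=
  (StructureSection (tsvalP (poly_mul sg s.2 + poly_mul sw s.1)),
   StructureSection (tsvalP (poly_mul su s.1 - poly_mul sf s.2))).

Lemma basis_map_linear :
  linear (basis_map : dsum (O_ (- e%:Z)) (O_ (- d%:Z)) U -> OO U).
Proof.
move=> a s t; congr pair; apply: structure_section_eq => y /=;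
  rewrite /= !fctE; ring.
Qed.

Definition quotient_map (s : structure_section U * structure_section U) :
    sky_section x U :=
  fun Ux => resK x A%:K * value_at Ux s.1 + resK x B%:K * value_at Ux s.2.

Lemma quotient_map_linear : linear (quotient_map : OO U -> Qx U).
Proof.
move=> a s t; apply/funext => Ux.
rewrite -[RHS]/(value_at Ux a * quotient_map s Ux + quotient_map t Ux).
by rewrite /quotient_map /= !rmorphD !rmorphM quadratic_collect.
Qed.

End Map.

Definition basis_omor : omor (dsum (O_ (- e%:Z)) (O_ (- d%:Z))) OO.
Proof.
apply: (@make_omor _ _ (dsum (O_ (- e%:Z)) (O_ (- d%:Z))) OO
  basis_map basis_map_linear) => U V VU s.
by congr pair; apply: structure_section_eq.
Defined.

Definition quotient_omor : omor OO Qx.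
Proof.
apply: (@make_omor _ _ OO Qx quotient_map quotient_map_linear) => U V VU s.
apply/funext => Vx; rewrite /quotient_map /= !(value_at_res VU _ Vx (VU _ Vx)).
by [].
Defined.

Lemma detK : g%:K * u%:K + f%:K * w%:K = (mi_poly p)%:K.
Proof. by rewrite -!tofracM -tofracD det. Qed.

Lemma basis_injective U s : basis_omor U s = 0 -> s = 0.
Proof.
case: s => s t st0.
pose S := structure_section U.
have a0 y : g%:K * tsval t y + w%:K * tsval s y = 0.
  exact: (congr1 (fun z : S * S => osval z.1 y) st0).
have b0 y : u%:K * tsval s y - f%:K * tsval t y = 0.
  exact: (congr1 (fun z : S * S => osval z.2 y) st0).
have sol y := cramer2 detK (mi_neq0 p) (esym (a0 y)) (esym (b0 y)).
by congr pair; apply: twist_section_eq => y; have [E1 E2] := sol y;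
  rewrite ?E1 ?E2 !mulr0 ?subr0 ?addr0 mulr0.
Qed.

Lemma quotient_mapE U (Ux : open_set U (Closed x)) (a b : structure_section U) :
  quotient_map (a, b) Ux =
    resK x (A%:K * osval a (exist _ _ Ux) + B%:K * osval b (exist _ _ Ux)).
Proof.
have aP := structure_section_ord Ux a; have bP := structure_section_ord Ux b.
have AP := ord_ge_poly p A; have BP := ord_ge_poly p B.
have AaP := ord_geMl AP aP; have BbP := ord_geMl BP bP.
by rewrite (resKD AaP BbP) (resKM AP aP) (resKM BP bP) -!value_atE.
Qed.

Lemma quotient_eq0 U (Ux : open_set U (Closed x)) (a b : structure_section U) :
  quotient_map (a, b) Ux = 0 <->
    ord_ge x 1 (A%:K * osval a (exist _ _ Ux) + B%:K * osval b (exist _ _ Ux)).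
Proof.
rewrite quotient_mapE resK_eq0 //.
by apply: ord_geD; apply: ord_geMl; rewrite ?twist0;
  first [exact: ord_ge_poly | exact: structure_section_ord].
Qed.

Lemma dvd_ABwu : mi_poly p %| A * w + B * u.
Proof.
have [nf|ng] : ~~ (mi_poly p %| f) \/ ~~ (mi_poly p %| g).
  by have := fg; rewrite /projective negb_and => /orP[]; [left|right].
- apply: contraTT isT => nABwu; have := mi_ndvdM nf nABwu.
  have -> : f * (A * w + B * u) = A * mi_poly p - u * (A * g - B * f).
    rewrite -det; ring.
  by rewrite dvdp_sub // dvdp_mull.
apply: contraTT isT => nABwu; have := mi_ndvdM ng nABwu.
have -> : g * (A * w + B * u) = B * mi_poly p + w * (A * g - B * f).
  rewrite -det; ring.
by rewrite dvdp_add // dvdp_mull.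
Qed.

Lemma quotient_basis U s : quotient_map (basis_map (U := U) s) = 0.
Proof.
apply/funext => Ux; case: s => s t; rewrite -[RHS]/(0 : residue_field x).
apply/quotient_eq0.
pose s0 := tsval s (exist _ _ Ux); pose t0 := tsval t (exist _ _ Ux).
have tord (n : int) (r : twist_section n U) : ord_ge x 0 (tsval r (exist _ _ Ux)).
  have /asboolP[_ /(_ (exist _ _ Ux))] := tsvalP r.
  by rewrite /twist_stalk /= oppr0.
rewrite -[X in ord_ge _ _ X]/(A%:K * (g%:K * t0 + w%:K * s0) +
                             B%:K * (u%:K * s0 - f%:K * t0)).
have -> : A%:K * (g%:K * t0 + w%:K * s0) + B%:K * (u%:K * s0 - f%:K * t0) =
    (A * g - B * f)%:K * t0 + (A * w + B * u)%:K * s0.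
  rewrite tofracB tofracD !tofracM; ring.
by apply: ord_geD; apply: ord_ge1_mod; rewrite ?dvd_ABwu //; exact: tord.
Qed.

(** Modulo [p] the kernel is a line, spanned by [(g, - f)] as well as by [(w, u)];
    the two numerators in Cramer's rule are determinants of [(a, b)] with these
    vectors. *)
Lemma in_kernel_ord a b : ord_ge x 0 a -> ord_ge x 0 b ->
  ord_ge x 1 (A%:K * a + B%:K * b) ->
  ord_ge x 1 (f%:K * a + g%:K * b) /\ ord_ge x 1 (u%:K * a - w%:K * b).
Proof.
move=> a0 b0 ABab.
have Pord (P : {poly F}) : ord_ge x 0 P%:K by exact: ord_ge_poly.
have fgab : ord_ge x 1 (f%:K * a + g%:K * b).
  apply: (projective_ord AB); first by apply: ord_geD; exact: ord_geMl.
    have -> : A%:K * (f%:K * a + g%:K * b) =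
        f%:K * (A%:K * a + B%:K * b) + (A * g - B * f)%:K * b.
      rewrite tofracB !tofracM; ring.
    by apply: ord_geD; [exact: ord_geMl | exact: ord_ge1_mod].
  have -> : B%:K * (f%:K * a + g%:K * b) =
      g%:K * (A%:K * a + B%:K * b) - (A * g - B * f)%:K * a.
    rewrite tofracB !tofracM; ring.
  by apply: ord_geB; [exact: ord_geMl | exact: ord_ge1_mod].
split=> //; apply: (projective_ord fg); first by apply: ord_geB; exact: ord_geMl.
  have -> : f%:K * (u%:K * a - w%:K * b) =
      u%:K * (f%:K * a + g%:K * b) - (mi_poly p)%:K * b.
    rewrite -detK; ring.
  by apply: ord_geB; [exact: ord_geMl | exact: ord_ge1_mod].
have -> : g%:K * (u%:K * a - w%:K * b) =
    (mi_poly p)%:K * a - w%:K * (f%:K * a + g%:K * b).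
  rewrite -detK; ring.
by apply: ord_geB; [exact: ord_ge1_mod | exact: ord_geMl].
Qed.

(** At infinity [p^-1] vanishes to order [d + e], which leaves order [j] after
    multiplication by polynomials of degree at most [i]. *)
Lemma cramer_stalk c a b P Q (j i : nat) : (j + i)%N = (d + e)%N ->
  (size P <= i.+1)%N -> (size Q <= i.+1)%N ->
  ord_ge c 0 a -> ord_ge c 0 b -> (c = x -> ord_ge x 1 (P%:K * a + Q%:K * b)) ->
  ord_ge c (- twist (- j%:Z) c) ((mi_poly p)%:K^-1 * (P%:K * a + Q%:K * b)).
Proof.
move=> ji sP sQ a0 b0; case: c a0 b0 => [r|] a0 b0 atx.
  rewrite twist_finite oppr0; have [rp|nrp] := pselect (r = p).
    rewrite rp -[0](addNr 1); apply: ord_geM; last by apply: atx; rewrite rp.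
    exists 1, 1; split; first exact: mi_ndvd1.
    by rewrite -exprN1 tofrac1 divr1 mulr1.
  apply: ord_geMl; first by apply: ord_ge_polyV; apply/negP => /mi_dvd_mi.
  by apply: ord_geD; apply: ord_geMl => //; exact: ord_ge_poly.
rewrite twist_infty opprK.
have -> : j%:Z = (d + e)%:Z + - i%:Z by lia.
apply: ord_geM.
  apply: ord_ge_infty_polyV; last by rewrite sp; lia.
  exact: irredp_neq0 (mi_irreducible p).
have mul (R : {poly F}) h : (size R <= i.+1)%N -> ord_ge (Infinity F) 0 h ->
    ord_ge (Infinity F) (- i%:Z) (R%:K * h).
  move=> sR h0; rewrite -[- _]addr0; apply: ord_geM => //.
  by apply: ord_ge_infty_poly; lia.
by apply: ord_geD; exact: mul.
Qed.

Lemma kernel_lift U (s : OO U) :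
  quotient_map (s : structure_section U * structure_section U) = 0 ->
  exists t, basis_omor U t = s.
Proof.
case: s => a b ab0.
have /asboolP[a1 _] := osvalP a; have /asboolP[b1 _] := osvalP b.
have kpt c (Uc : open_set U (Closed c)) : c = x ->
    ord_ge x 1 (f%:K * osval a (exist _ _ Uc) + g%:K * osval b (exist _ _ Uc)) /\
    ord_ge x 1 (u%:K * osval a (exist _ _ Uc) - w%:K * osval b (exist _ _ Uc)).
  move=> cx; move: Uc; rewrite cx => Ux.
  apply: in_kernel_ord; try exact: structure_section_ord.
  by apply/quotient_eq0; rewrite ab0.
have sE : (fun y => (mi_poly p)%:K^-1 * (f%:K * osval a y + g%:K * osval b y))
    \in @section_pred F (- e%:Z) U.
  apply/asboolP; split=> [y z|]; first by rewrite (a1 y z) (b1 y z).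
  case=> -[//|c] Uc; apply: (cramer_stalk (i := d)) => //; first by rewrite addnC.
  - exact: structure_section_ord.
  - exact: structure_section_ord.
  - by move=> cx; have [] := kpt c Uc cx.
have sD : (fun y => (mi_poly p)%:K^-1 * (u%:K * osval a y - w%:K * osval b y))
    \in @section_pred F (- d%:Z) U.
  apply/asboolP; split=> [y z|]; first by rewrite (a1 y z) (b1 y z).
  case=> -[//|c] Uc /=; rewrite -mulNr -tofracN.
  apply: (cramer_stalk (i := e)) => //; rewrite ?size_polyN //.
  - exact: structure_section_ord.
  - exact: structure_section_ord.
  - by move=> cx; rewrite tofracN mulNr; have [] := kpt c Uc cx.
exists ((TwistSection sE, TwistSection sD) : dsum (O_ (- e%:Z)) (O_ (- d%:Z)) U).
by congr pair; apply: structure_section_eq => y /=;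
  have [E1 E2] := cramer2V (osval a y) (osval b y) detK (mi_neq0 p).
Qed.

Lemma quotient_surjective U (z : Qx U) : in_image quotient_omor z.
Proof.
move=> y Uy; have [yx|nyx] := pselect (y = Closed x); last first.
  have oV : open (open_set U `&` open_set (punctured x)).
    by apply: openI; exact: open_setP.
  exists (Opens oV), (@subIsetl _ _ _); split=> //; exists 0.
  by apply/funext => Vx; case: (Vx.2).
have oV : open (open_set U `&` open_set (punctured (Infinity F))).
  by apply: openI; exact: open_setP.
pose V := Opens oV; have VU : V `<=` U by exact: subIsetl.
have Vx : open_set V (Closed x) by split=> //; rewrite -yx.
exists V, VU; split; first by rewrite yx.
have Vinf : ~ open_set V (Closed (Infinity F)) by move=> [_ /punctured_neq].
pose poly := poly_section Vinf.
have [Q QE] := resK_poly_surj ((z : sky_section x U) (VU _ Vx)).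
have [P [P' PE]] : exists P P', mi_poly p %| A * P + B * P' - Q.
  have := AB; rewrite /projective negb_and => /orP[] /mi_coprime[v vE].
    exists (v * Q), 0; have -> : A * (v * Q) + B * 0 - Q = (v * A - 1) * Q by ring.
    exact: dvdp_mulr.
  exists 0, (v * Q); have -> : A * 0 + B * (v * Q) - Q = (v * B - 1) * Q by ring.
  exact: dvdp_mulr.
exists ((poly P, poly P') : OO V); apply/funext => Vx'.
rewrite (Prop_irrelevance Vx' Vx) -[RHS]/((z : sky_section x U) (VU _ Vx)) -QE.
apply: etrans (quotient_mapE Vx (poly P) (poly P')) _.
by rewrite /= -!tofracM -tofracD; apply/resK_poly_eq.
Qed.

Lemma basis_exact : short_exact basis_omor quotient_omor.
Proof.
split; [exact: basis_injective | | exact: quotient_surjective].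
move=> U s; split=> [/kernel_lift[t tE] y Uy|loc].
  by exists U, (fun y h => h); split=> //; exists t; rewrite mres_id.
apply/funext => Ux; have [V [VU [Vx [t tE]]]] := loc _ Ux.
have := congr1 (fun h : sky_section x V => h Vx) (quotient_basis t).
rewrite -[basis_map t]/(basis_omor V t) tE => E.
apply: etrans (E).
rewrite -[quotient_map _]/(quotient_omor V (mres VU s)) omap_res.
by rewrite (Prop_irrelevance Ux (VU _ Vx)).
Qed.

Lemma reduced_basis_ses : exists t : ses OO Qx,
  represents t A B /\ ses_left t = dsum (O_ (- e%:Z)) (O_ (- d%:Z)).
Proof.
exists (SES basis_exact); split=> // U Ux a b.
by rewrite -!value_atE.
Qed.

End ReducedBasis.

(** * Heights of points of the projective line over the residue field *)

Section Strata.
Variables (F : finFieldType) (p : monic_irreducible F) (N : nat).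
Hypothesis sp : size (mi_poly p) = N.+1.
Implicit Types (A B P Q f g : {poly F}) (d : nat).

Lemma small_dvd P : (size P <= N)%N -> mi_poly p %| P -> P = 0.
Proof.
move=> sP pP; apply: contraTeq sP => P0.
by rewrite -ltnNge -sp dvdp_leq.
Qed.

Lemma mi_dvdM P Q : mi_poly p %| P * Q -> mi_poly p %| P \/ mi_poly p %| Q.
Proof.
move=> pPQ; apply/orP; apply: contraTT pPQ; rewrite negb_or => /andP[nP nQ].
exact: mi_ndvdM.
Qed.

Lemma projective_dvd A B P : projective p A B ->
  mi_poly p %| A * P -> mi_poly p %| B * P -> mi_poly p %| P.
Proof.
rewrite /projective negb_and => AB /mi_dvdM[pA|//] /mi_dvdM[pB|//].
by move: AB; rewrite pA pB.
Qed.

Lemma coprime_projective f g : coprimep f g -> projective p f g.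
Proof.
move=> cop; apply/negP => /andP[pf pg]; have := mi_ndvd1 p.
have g1 : gcdp f g %= 1 by rewrite -size_poly_eq1.
by rewrite -(eqp_dvdr _ g1) dvdp_gcd pf pg.
Qed.

Definition same_point (z t : {poly F} * {poly F}) :=
  mi_poly p %| z.1 * t.2 - t.1 * z.2.

Lemma same_point_sym z t : same_point z t -> same_point t z.
Proof. by rewrite /same_point -dvdpNr opprB. Qed.

Lemma same_point_trans t z v : projective p t.1 t.2 ->
  same_point z t -> same_point t v -> same_point z v.
Proof.
move=> tP zt tv; apply: (projective_dvd tP).
  have -> : t.1 * (z.1 * v.2 - v.1 * z.2) =
      z.1 * (t.1 * v.2 - v.1 * t.2) + v.1 * (z.1 * t.2 - t.1 * z.2) by ring.
  by rewrite dvdp_add // dvdp_mull.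
have -> : t.2 * (z.1 * v.2 - v.1 * z.2) =
    v.2 * (z.1 * t.2 - t.1 * z.2) + z.2 * (t.1 * v.2 - v.1 * t.2) by ring.
by rewrite dvdp_add // dvdp_mull.
Qed.

(** The point [[A : B]] is the reduction modulo [p] of a rational function [f / g]
    of degree [d]. *)
Definition has_height A B d := exists f g,
  [/\ coprimep f g, maxn (size f) (size g) = d.+1 & mi_poly p %| A * g - f * B].

(** There are more pairs of polynomials of degree at most [N / 2] than residues
    modulo [p], so two of them give the same residue of [A * g - f * B]; their
    difference, divided by its gcd, represents [[A : B]]. *)
Lemma has_height_exists A B : (0 < N)%N -> projective p A B ->
  exists2 d, (d.*2 <= N)%N & has_height A B d.
Proof.
move=> N0 AB; pose h := N./2.+1.
have h2 : (N < h + h)%N by rewrite /h; lia.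
have hN : (h <= N)%N by rewrite /h; lia.
pose phi (z : 'rV[F]_h * 'rV[F]_h) : 'rV[F]_N :=
  poly_rV ((A * rVpoly z.2 - rVpoly z.1 * B) %% mi_poly p).
have /injectivePn[z [t ztn zt]] : ~~ injectiveb phi.
  apply/negP => /injectiveP/leq_card; rewrite card_prod !card_mx !mul1n -expnD.
  by rewrite leqNgt ltn_exp2l ?h2 // card_finNzRing_gt1.
pose f := rVpoly (z.1 - t.1); pose g := rVpoly (z.2 - t.2).
have pfg : mi_poly p %| A * g - f * B.
  have modN P : (size (P %% mi_poly p)%R <= N)%N.
    by rewrite -ltnS -sp ltn_modp irredp_neq0 //; exact: mi_irreducible.
  have := congr1 rVpoly zt; rewrite /phi !poly_rV_K // => /eqP.
  rewrite -subr_eq0 -modpN -modpD => /eqP E; rewrite /dvdp.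
  have -> : A * g - f * B = A * rVpoly z.2 - rVpoly z.1 * B +
      - (A * rVpoly t.2 - rVpoly t.1 * B) by rewrite /f /g !linearB /=; ring.
  by rewrite E.
have fg0 : (f != 0) || (g != 0).
  rewrite -negb_and; apply: contra ztn => /andP[/eqP f0 /eqP g0]; apply/eqP.
  have rV0 (r : 'rV[F]_h) : rVpoly r = 0 -> r = 0.
    by move=> r0; rewrite -(rVpolyK r) r0 linear0.
  move/rV0: f0 => /subr0_eq f0; move/rV0: g0 => /subr0_eq g0.
  by rewrite [z]surjective_pairing f0 g0 -surjective_pairing.
pose c := gcdp f g; have c0 : c != 0 by rewrite gcdp_eq0 negb_and.
pose f' := f %/ c; pose g' := g %/ c.
have fE : f = f' * c by rewrite divpK // dvdp_gcdl.
have gE : g = g' * c by rewrite divpK // dvdp_gcdr.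
have sfh : (size f <= h)%N by exact: size_poly.
have sgh : (size g <= h)%N by exact: size_poly.
have cop : coprimep f' g' by apply: coprimep_div_gcd.
have pc : ~~ (mi_poly p %| c).
  apply/negP => pc; move: fg0.
  rewrite (small_dvd (leq_trans sfh hN) (dvdp_trans pc (dvdp_gcdl f g))).
  by rewrite (small_dvd (leq_trans sgh hN) (dvdp_trans pc (dvdp_gcdr f g))) eqxx.
have sdiv (P : {poly F}) : (size (P %/ c)%R <= size P)%N by exact: leq_divp.
have m0 : (0 < maxn (size f') (size g'))%N.
  rewrite leq_max !size_poly_gt0 -negb_and.
  apply: contraL fg0 => /andP[/eqP f0 /eqP g0].
  by rewrite fE gE f0 g0 !mul0r eqxx.
exists (maxn (size f') (size g')).-1.
  have : (maxn (size f') (size g') <= h)%N.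
    by rewrite geq_max !(leq_trans (sdiv _)).
  move: m0; rewrite /h -addnn; lia.
exists f', g'; split; rewrite ?prednK //.
have : mi_poly p %| (A * g' - f' * B) * c.
  by rewrite mulrBl -mulrA -gE mulrAC -fE.
by case/mi_dvdM => //; rewrite (negPf pc).
Qed.

End Strata.

(** * Counting the points of given height *)

Section Counting.
Variables (F : finFieldType) (p : monic_irreducible F) (N : nat).
Hypothesis sp : size (mi_poly p) = N.+1.
Implicit Types (A B P Q f g : {poly F}) (d : nat).

Local Notation q := #|F|.

(** The points of the projective line over the residue field: [Some r] stands for
    the affine point whose coordinate is the residue of the polynomial [rVpoly r]
    of degree less than [N], and [None] for the point at infinity. *)
Definition point := option 'rV[F]_N.

Definition coords (c : point) : {poly F} * {poly F} :=
  if c is Some r then (rVpoly r, 1) else (1, 0).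

Lemma coords_projective c : projective p (coords c).1 (coords c).2.
Proof.
by apply: coprime_projective; case: c => [r|] /=; rewrite ?coprimep1 ?coprime1p.
Qed.

Lemma coords_inj c c' : same_point p (coords c) (coords c') -> c = c'.
Proof.
have n1 : ~~ (mi_poly p %| -1) by rewrite dvdpNr mi_ndvd1.
case: c c' => [r|] [r'|] //=; rewrite /same_point /=.
- rewrite !mulr1 => /(small_dvd sp) E; congr Some.
  have : rVpoly (r - r') = 0 by rewrite linearB /= E // -linearB size_poly.
  by move=> /(congr1 (@poly_rV F N)); rewrite rVpolyK linear0 => /subr0_eq.
- by rewrite mulr0 mulr1 sub0r (negPf n1).
- by rewrite mulr0 mulr1 subr0 (negPf (mi_ndvd1 p)).
Qed.

Lemma coords_exist z : projective p z.1 z.2 -> exists c, same_point p z (coords c).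
Proof.
case: z => A B /=; rewrite /projective negb_and => AB.
have [pB|nB] := boolP (mi_poly p %| B).
  by exists None; rewrite /same_point /= mulr0 mul1r sub0r dvdpNr.
have [u uB] := mi_coprime nB.
exists (Some (poly_rV ((A * u) %% mi_poly p))); rewrite /same_point /=.
rewrite poly_rV_K; last first.
  by rewrite -ltnS -sp ltn_modp irredp_neq0 //; exact: mi_irreducible.
have -> : A * 1 - (A * u) %% mi_poly p * B =
    (A * u) %/ mi_poly p * B * mi_poly p - A * (u * B - 1).
  have -> : A * (u * B - 1) = A * u * B - A by ring.
  rewrite {3}(divp_eq (A * u) (mi_poly p)); ring.
by rewrite dvdp_sub // dvdp_mull.
Qed.

Definition stratum d : {set point} :=
  [set c | `[< has_height p (coords c).1 (coords c).2 d >]].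

Lemma stratumP c d :
  reflect (has_height p (coords c).1 (coords c).2 d) (c \in stratum d).
Proof. by rewrite inE; exact: asboolP. Qed.

Lemma card_point : #|{: point}| = (q ^ N).+1.
Proof. by rewrite card_option card_mx mul1n. Qed.

(** Two rational functions of degree [d] that agree modulo [p] are equal, because
    the cross difference of their numerators and denominators has degree at most
    [2 * d < N].  So the points of height [d] are counted by the rational functions
    of degree [d], of which [phi] is a parametrization. *)
Lemma card_stratum (T : finType) (phi : T -> {poly F} * {poly F}) d :
  (d.*2 < N)%N ->
  (forall t, coprimep (phi t).1 (phi t).2 /\
             maxn (size (phi t).1) (size (phi t).2) = d.+1) ->
  (forall f g, coprimep f g -> maxn (size f) (size g) = d.+1 ->
     exists t (l : F), [/\ l != 0, f = l *: (phi t).1 & g = l *: (phi t).2]) ->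
  (forall t t', (phi t).1 * (phi t').2 = (phi t').1 * (phi t).2 -> t = t') ->
  #|stratum d| = #|T|.
Proof.
move=> dN phiP phi_surj phi_inj.
have proj t : projective p (phi t).1 (phi t).2.
  by apply: coprime_projective; case: (phiP t).
pose code t := sval (cid (coords_exist (proj t))).
have codeP t : same_point p (phi t) (coords (code t)).
  exact: (proj2_sig (cid (coords_exist (proj t)))).
have code_inj : injective code.
  move=> t t' E; apply: phi_inj; apply/subr0_eq; apply: (small_dvd sp).
    have [[_ m] [_ m']] := (phiP t, phiP t').
    have sz (P Q : {poly F}) : (size P <= d.+1)%N -> (size Q <= d.+1)%N ->
        (size (P * Q)%R <= N)%N.
      move=> sP sQ; apply: leq_trans (size_polyMleq _ _) _.
      by move: dN sP sQ; rewrite -addnn; lia.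
    apply: leq_trans (size_polyD _ _) _; rewrite size_polyN geq_max.
    by rewrite !sz // -?m -?m' ?leq_maxl ?leq_maxr // m -m' ?leq_maxl ?leq_maxr.
  have := codeP t'; rewrite -E => /same_point_sym.
  by apply: same_point_trans (codeP t); exact: coords_projective.
rewrite -cardsT -(card_imset _ code_inj); apply: eq_card => c.
apply/stratumP/imsetP.
  move=> [f [g [cop mfg cfg]]]; have [t [l [l0 fE gE]]] := phi_surj f g cop mfg.
  exists t => //; apply: coords_inj; apply: same_point_trans (proj t) _ (codeP t).
  have -> : same_point p (coords c) (phi t) =
      (mi_poly p %| l *: ((coords c).1 * (phi t).2 - (phi t).1 * (coords c).2)).
    by rewrite dvdpZr.
  by rewrite scalerBr scalerAr scalerAl -fE -gE.
move=> [t _ ->]; have [cop mt] := phiP t.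
by exists (phi t).1, (phi t).2; split=> //; apply: same_point_sym; exact: codeP.
Qed.

Lemma card_stratum0 : (0 < N)%N -> #|stratum 0| = q.+1.
Proof.
move=> N0; rewrite -card_option.
pose phi (t : option F) : {poly F} * {poly F} :=
  if t is Some a then (a%:P, 1) else (1, 0).
apply: (@card_stratum _ phi) => //.
- case=> [a|] /=; rewrite ?coprimep1 ?coprime1p size_poly1 ?size_poly0 //.
  by split=> //; apply/maxn_idPr; exact: size_polyC_leq1.
- move=> f g _ m1.
  have [sf sg] : (size f <= 1)%N /\ (size g <= 1)%N.
    by rewrite -m1 leq_maxl leq_maxr.
  have [g0|g0] := eqVneq g 0.
    exists None, f`_0; rewrite /= g0 scaler0 -mul_polyC mulr1 -size1_polyC //.
    split=> //; apply/eqP => f0; move: m1.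
    by rewrite (size1_polyC sf) f0 g0 size_poly0.
  have g00 : g`_0 != 0.
    by apply: contra g0 => /eqP g00; rewrite (size1_polyC sg) g00.
  exists (Some (f`_0 / g`_0)), g`_0; split=> //=.
    by rewrite -mul_polyC -polyCM mulrC divfK // -size1_polyC.
  by rewrite -mul_polyC mulr1 -size1_polyC.
- case=> [a|] [b|] //=; rewrite ?mulr1 ?mulr0 ?mul1r.
  + by move/polyC_inj ->.
  + by move/eqP; rewrite eq_sym oner_eq0.
  + by move/eqP; rewrite oner_eq0.
Qed.

Lemma size_linear (a b : F) : (size (a%:P * 'X + b%:P)%R <= 2)%N.
Proof.
by rewrite size_MXaddC; case: ifP => // _; rewrite ltnS size_polyC_leq1.
Qed.

Lemma size_linear_eq (a b : F) : a != 0 -> size (a%:P * 'X + b%:P) = 2%N.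
Proof. by move=> a0; rewrite size_MXaddC polyC_eq0 (negPf a0) size_polyC a0. Qed.

Lemma linear_coef P : (size P <= 2)%N -> P = (P`_1)%:P * 'X + (P`_0)%:P.
Proof.
move=> sP; apply/polyP => -[|[|i]]; rewrite coefD coefMX !coefC //=.
- by rewrite add0r.
- by rewrite addr0.
- by rewrite addr0 nth_default //; apply: leq_trans sP _.
Qed.

(** A rational function of degree 1 is either [e * X + a] or [a + e / (X - r)], with
    [e != 0] in both cases. *)
Lemma card_stratum1 : (2 < N)%N -> #|stratum 1| = (q.-1 * q * q.+1)%N.
Proof.
move=> N2.
pose phi (t : {e : F | e != 0} * F * option F) : {poly F} * {poly F} :=
  let: (e, a, o) := t in
  if o is Some r then (a%:P * ('X - r%:P) + (sval e)%:P, 'X - r%:P)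
  else ((sval e)%:P * 'X + a%:P, 1).
have -> : (q.-1 * q * q.+1)%N = #|{: {e : F | e != 0} * F * option F}|.
  rewrite !card_prod card_option card_sig; congr (_ * _ * _)%N.
  by rewrite (cardC1 (0 : F)).
apply: (@card_stratum _ phi) => //.
- case=> [[[e e0] a] [r|]] /=; last by rewrite coprimep1 size_linear_eq ?size_poly1.
  split.
    by rewrite coprimep_XsubC /root !hornerE /= subrr mulr0 add0r.
  rewrite size_XsubC; apply/maxn_idPr.
  have -> : a%:P * ('X - r%:P) + e%:P = a%:P * 'X + (e - a * r)%:P.
    rewrite polyCB polyCM; ring.
  exact: size_linear.
- move=> f g cop m2.
  have [sf sg] : (size f <= 2)%N /\ (size g <= 2)%N.
    by rewrite -m2 leq_maxl leq_maxr.
  have fE := linear_coef sf; have gE := linear_coef sg.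
  have [g1|g1] := eqVneq g`_1 0.
    rewrite g1 mul0r add0r in gE.
    have g0 : g`_0 != 0.
      apply/eqP => g00; move: m2 cop; rewrite gE g00 size_poly0 maxn0 coprimep0.
      by move=> sf2; rewrite -size_poly_eq1 sf2.
    have f1 : f`_1 != 0.
      apply/eqP => f1; rewrite f1 mul0r add0r in fE; move: m2.
      rewrite fE gE => m2.
      have : (maxn (size (f`_0)%:P) (size (g`_0)%:P) <= 1)%N.
        by rewrite geq_max !size_polyC_leq1.
      by rewrite m2.
    have e0 : f`_1 / g`_0 != 0 by rewrite mulf_neq0 ?invr_eq0.
    exists (exist (fun e : F => e != 0) _ e0, f`_0 / g`_0, None), g`_0; split=> //=.
      rewrite -mul_polyC mulrDr mulrA -!polyCM ![g`_0 * _]mulrC !divfK //.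
    by rewrite -mul_polyC mulr1.
  pose r := - (g`_0 / g`_1).
  have gE' : g = g`_1 *: ('X - r%:P).
    have g1r : g`_1 * r = - g`_0 by rewrite /r mulrN mulrC divfK.
    by rewrite -mul_polyC mulrBr -polyCM g1r polyCN opprK -gE.
  have fr : f.[r] != 0.
    by move: cop; rewrite gE' coprimepZr // coprimep_XsubC.
  have e0 : f.[r] / g`_1 != 0 by rewrite mulf_neq0 ?invr_eq0.
  exists (exist (fun e : F => e != 0) _ e0, f`_1 / g`_1, Some r), g`_1; split=> //=.
  rewrite -mul_polyC mulrDr mulrA -!polyCM ![g`_1 * _]mulrC !divfK //.
  rewrite [f.[r]](congr1 (horner^~ r) fE) !hornerE {1}fE polyCD polyCM; ring.
- have root_eq e (e0 : e != 0) (a r r' : F) P :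
      (a%:P * ('X - r%:P) + e%:P) * ('X - r'%:P) = P * ('X - r%:P) -> r = r'.
    move/(congr1 (horner^~ r)); rewrite !hornerE /= subrr !mulr0 add0r => /eqP.
    by rewrite mulf_eq0 (negPf e0) subr_eq0 => /eqP.
  case=> [[[e e0] a] [r|]] [[[e' e'0] a'] [r'|]] /= E.
  + have rr' := root_eq e e0 a r r' _ E; subst r'.
    have {}E : a%:P * ('X - r%:P) + e%:P = a'%:P * ('X - r%:P) + e'%:P.
      by apply: mulIf E; rewrite polyXsubC_eq0.
    have ee' : e = e'.
      by have := congr1 (horner^~ r) E; rewrite !hornerE /= subrr !mulr0 !add0r.
    have aa' : a = a'.
      move: E; rewrite ee' => /addIr /mulIf.
      by move/(_ (negbT (polyXsubC_eq0 r))) /polyC_inj.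
    by rewrite aa'; congr (_, _, _); apply: val_inj.
  + have : e = 0.
      have := congr1 (horner^~ r) E; rewrite !hornerE /= subrr !mulr0 add0r.
      by [].
    by move/eqP; rewrite (negPf e0).
  + have : e' = 0.
      have := congr1 (horner^~ r') E; rewrite !hornerE /= subrr !mulr0 add0r.
      by [].
    by move/eqP; rewrite (negPf e'0).
  + rewrite !mulr1 in E; have aa' : a = a'.
      by have := congr1 (horner^~ 0) E; rewrite !hornerE.
    have ee' : e = e'.
      move: E; rewrite aa' => /addIr /mulIf.
      by move/(_ (negbT (polyX_eq0 F))) /polyC_inj.
    by rewrite aa'; congr (_, _, _); apply: val_inj.
Qed.

End Counting.

(** * Multiplicities of the split bundles *)

Section Multiplicities.
Variables (F : finFieldType) (p : monic_irreducible F) (N : nat).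
Hypothesis sp : size (mi_poly p) = N.+1.
Notation OP1 := (structure_sheaf F).
Notation x := (Finite p).
Notation OO := (dsum (self_module OP1) (self_module OP1)).
Implicit Types (A B : {poly F}) (d : nat).

Definition split_bundle d : omodule OP1 := dsum (O_ (- (N - d)%N%:Z)) (O_ (- d%:Z)).

Lemma ses_of_height A B d : (d.*2 <= N)%N -> projective p A B ->
  has_height p A B d ->
  exists t : ses OO (skyscraper x), represents t A B /\ ses_left t = split_bundle d.
Proof.
move=> dN AB [f [g [cop m pAB]]].
have spN : (size (mi_poly p) <= N.+1)%N by rewrite sp.
have [u [w [det su sw]]] := bezout_bounded cop m dN spN.
have dN' : (d <= N)%N by apply: leq_trans dN; rewrite -addnn leq_addr.
apply: (@reduced_basis_ses F p A B f g u w d (N - d)) => //.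
- exact: coprime_projective.
- by rewrite [B * f]mulrC.
- by rewrite subnKC.
- by rewrite -m leq_maxl.
- by rewrite -m leq_maxr.
Qed.

Lemma split_bundle_inj d d' : (d.*2 <= N)%N -> (d'.*2 <= N)%N ->
  isomorphic (split_bundle d) (split_bundle d') -> d = d'.
Proof.
have aux a b : (a < b)%N -> (b.*2 <= N)%N ->
    ~ isomorphic (split_bundle a) (split_bundle b).
  by move=> ab bN; apply: not_isomorphic_dsum_O; move: bN; rewrite -addnn; lia.
move=> dN d'N iso; case: (ltngtP d d') => // [dd'|d'd].
  by case: (aux _ _ dd' d'N).
by case: (aux _ _ d'd dN); exact: isomorphic_sym.
Qed.

Lemma has_height_uniq A B d d' :
  projective p A B -> (d.*2 <= N)%N -> (d'.*2 <= N)%N ->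
  has_height p A B d -> has_height p A B d' -> d = d'.
Proof.
move=> AB dN d'N /(ses_of_height dN AB)[t [tAB tE]].
move=> /(ses_of_height d'N AB)[t' [t'AB t'E]]; apply: split_bundle_inj => //.
rewrite -tE -t'E; apply: ses_iso_left; apply/(represents_iso tAB t'AB).
by rewrite subrr dvdp0.
Qed.

(** Every sequence is isomorphic to one of the sequences built from a reduced
    basis, one for each point of the projective line over the residue field. *)
Lemma ses_code (t : ses OO (skyscraper x)) : (0 < N)%N ->
  exists d (c : point F N) (s : ses OO (skyscraper x)),
    [/\ (d.*2 <= N)%N, c \in stratum p N d,
        represents s (coords c).1 (coords c).2, ses_left s = split_bundle d
      & ses_iso t s].
Proof.
move=> N0; have [A [B tAB]] := represents_exist t.
have AB := represents_projective tAB.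
have [c ABc] := @coords_exist F p N sp (A, B) AB.
have cP := coords_projective p c.
have [d dN cd] := has_height_exists sp N0 cP.
have [s [sc sE]] := ses_of_height dN cP cd.
exists d, c, s; split=> //; first exact/stratumP.
exact/(represents_iso tAB sc).
Qed.

Lemma multiplicity_split_bundle d : (0 < N)%N -> (d.*2 <= N)%N ->
  has_multiplicity x (split_bundle d) OO #|stratum p N d|.
Proof.
move=> N0 dN; set S := stratum p N d.
have ex (c : point F N) : c \in S -> exists t : ses OO (skyscraper x),
    represents t (coords c).1 (coords c).2 /\ ses_left t = split_bundle d.
  by move=> /stratumP; apply: ses_of_height => //; exact: coords_projective.
pose s (i : 'I_#|S|) := sval (cid (ex _ (enum_valP i))).
have sP i : represents (s i) (coords (enum_val i)).1 (coords (enum_val i)).2 /\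
    ses_left (s i) = split_bundle d.
  exact: (proj2_sig (cid (ex _ (enum_valP i)))).
exists s; split=> [i|i j sij|t tE].
- by rewrite (sP i).2; exact: isomorphic_refl.
- apply: enum_val_inj; apply: (coords_inj sp).
  exact/(represents_iso (sP i).1 (sP j).1).
have [d' [c [t' [d'N cd' t'c t'E tt']]]] := ses_code t N0.
have dd' : d' = d.
  apply: split_bundle_inj => //; apply: isomorphic_trans tE.
  by rewrite -t'E; apply: isomorphic_sym; exact: ses_iso_left.
have cS : c \in S by rewrite /S -dd'.
have [A [B tAB]] := represents_exist t.
exists (enum_rank_in cS c); apply/(represents_iso tAB (sP _).1).
by rewrite enum_rankK_in //; apply/(represents_iso tAB t'c).
Qed.

Lemma hecke_split_bundle (E' : omodule OP1) : (0 < N)%N ->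
  hecke_modification x E' OO <->
  exists d, [/\ (d.*2 <= N)%N, (0 < #|stratum p N d|)%N
              & isomorphic E' (split_bundle d)].
Proof.
move=> N0; split.
  move=> [_ [_ _ [f [g fg]]]].
  have [d [c [s [dN cd _ sE iso]]]] := ses_code (SES fg) N0.
  exists d; split=> //; first by apply/card_gt0P; exists c.
  by rewrite -sE; exact: (ses_iso_left iso).
move=> [d [dN /card_gt0P[c /stratumP cd] iso]].
have [t [_ tE]] := ses_of_height dN (coords_projective p c) cd.
have [h [h' hh']] : isomorphic E' (ses_left t) by rewrite tE.
exists 2; split.
- exact: locally_free_dsum_self.
- by apply: locally_free_iso (isomorphic_sym iso) _; exact: locally_free_dsum_O.
have [inj ker surj] := ses_exact t.
exists (omor_comp (ses_inj t) h), (ses_proj t); split=> //.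
  move=> U s /inj hs0; have [hK _] := hh' U.
  by rewrite -[s]hK hs0 raddf0.
move=> U s; split=> [/ker loc y Uy|loc].
  have [V [VU [Vy [u uE]]]] := loc y Uy; exists V, VU; split=> //.
  by exists (h' V u); have [_ h'K] := hh' V; rewrite -uE -[in RHS](h'K u).
apply/ker => y Uy; have [V [VU [Vy [u uE]]]] := loc y Uy.
by exists V, VU; split=> //; exists (h V u).
Qed.

Lemma stratum_partition : (0 < N)%N ->
  (\sum_(d < N./2.+1) #|stratum p N d| = (#|F| ^ N).+1)%N.
Proof.
move=> N0; have half d : (d < N./2.+1)%N = (d.*2 <= N)%N by lia.
have strE d : #|stratum p N d| = (\sum_(c : point F N) (c \in stratum p N d))%N.
  by rewrite -sum1_card big_mkcond; apply: eq_bigr => c _; case: (c \in _).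
under eq_bigr do rewrite strE; rewrite exchange_big -card_point -sum1_card /=.
apply: eq_bigr => c _; have cP := coords_projective p c.
have [d dN cd] := has_height_exists sp N0 cP.
have dh : (d < N./2.+1)%N by rewrite half.
rewrite (bigD1 (Ordinal dh)) //= big1 ?addn0.
  by have /stratumP -> := cd.
move=> d' d'd; apply/eqP; rewrite eqb0; apply: contra d'd => /stratumP cd'.
apply/eqP/val_inj => /=; apply: (has_height_uniq cP _ dN cd' cd).
by rewrite -half.
Qed.

End Multiplicities.

(** * The degree of a closed point *)

Section Degree.
Variable F : finFieldType.
Implicit Types d : nat.

Lemma const_residueE (c : closed_point F) (a : F) :
  const_residue c a = resK c (a%:P)%:K.
Proof. by rewrite /const_residue -resKE. Qed.

(** A fraction [a / b] regular at infinity has the same value there as the ratio of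
    the coefficients of [a] and [b] in degree [deg b], so every residue is
    constant. *)
Lemma degree_infinity d : has_degree (Infinity F) d -> (d <= 1)%N.
Proof.
move=> [e eP].
have const (z : residue_field (Infinity F)) : exists a, z = const_residue _ a.
  have [k k0 <-] := resK_surj z; have [a [b [b0 kE sab]]] := k0.
  pose n := (size b).-1; pose l := a`_n / b`_n.
  have bn : b`_n != 0 by rewrite -/(lead_coef b) lead_coef_eq0.
  have sb : (0 < size b)%N by rewrite size_poly_gt0.
  exists l; rewrite const_residueE; apply/resK_eq => //; first exact: ord_geC.
  exists (a - l *: b), b; split=> //.
    rewrite tofracB -mul_polyC tofracM mulrBl mulfK ?tofrac_eq0 //.
    by rewrite kE.
  have : (size (a - l *: b)%R <= n)%N.
    apply/leq_sizeP => j; rewrite leq_eqVlt coefB coefZ => /predU1P[<-|nj].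
      by rewrite divfK // subrr.
    have bj : (size b <= j)%N by rewrite -(prednK sb).
    have aj : (size a <= j)%N.
      by apply: leq_trans bj; move: sab; rewrite addr0 lez_nat.
    by rewrite !nth_default // mulr0 subrr.
  by rewrite -PoszD lez_nat addn1 -[size b in X in _ -> X](prednK sb).
pose val (a : {ffun 'I_d -> F}) := \sum_i const_residue (Infinity F) (a i) * e i.
pose phi a := sval (cid (const (val a))).
have phiE a : val a = const_residue _ (phi a).
  exact: (proj2_sig (cid (const (val a)))).
have phi_inj : injective phi.
  move=> a b ab; have [c [_ uniq]] := eP (val a).
  by rewrite -(uniq a erefl); apply: uniq; rewrite phiE ab -phiE.
have := leq_card phi phi_inj; rewrite card_ffun card_ord -{2}(expn1 #|F|).
by rewrite leq_exp2l // card_finNzRing_gt1.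
Qed.

(** Both the polynomials of degree less than that of [p] and the coordinate vectors
    in a basis enumerate the residue field without repetition, and the base field
    is finite, so cardinals can be compared. *)
Lemma degree_finite (p : monic_irreducible F) d :
  has_degree (Finite p) d -> size (mi_poly p) = d.+1.
Proof.
move=> [e eP]; pose n := (size (mi_poly p)).-1.
have sp : size (mi_poly p) = n.+1.
  by rewrite /n prednK // size_poly_gt0 irredp_neq0 //; exact: mi_irreducible.
pose val (a : {ffun 'I_d -> F}) := \sum_i const_residue (Finite p) (a i) * e i.
have val_inj a b : val a = val b -> a = b.
  move=> ab; have [c [_ uniq]] := eP (val a).
  by rewrite -(uniq a erefl); apply: uniq.
have val_surj z : exists a, val a = z by have [a [-> _]] := eP z; exists a.
pose red (r : 'rV[F]_n) := resK (Finite p) (rVpoly r)%:K.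
have red_inj r r' : red r = red r' -> r = r'.
  move=> /resK_poly_eq; rewrite -linearB /= => /(small_dvd sp).
  move/(_ (size_poly _ _)) => E.
  by apply/subr0_eq; rewrite -[r - r']rVpolyK E linear0.
have red_surj z : exists r, red r = z.
  have [P <-] := resK_poly_surj z; exists (poly_rV (P %% mi_poly p)).
  apply/resK_poly_eq; rewrite poly_rV_K; last first.
    by rewrite -ltnS -sp ltn_modp irredp_neq0 //; exact: mi_irreducible.
  by rewrite {2}(divp_eq P (mi_poly p)) opprD addrCA subrr addr0 dvdpNr dvdp_mull.
pose phi r := sval (cid (val_surj (red r))).
have phiE r : val (phi r) = red r by exact: (proj2_sig (cid (val_surj (red r)))).
pose psi a := sval (cid (red_surj (val a))).
have psiE a : red (psi a) = val a by exact: (proj2_sig (cid (red_surj (val a)))).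
have phi_bij : bijective phi.
  exists psi => r; first by apply: red_inj; rewrite psiE phiE.
  by apply: val_inj; rewrite phiE psiE.
have := bij_eq_card phi_bij; rewrite card_mx mul1n card_ffun card_ord sp => /eqP.
by rewrite eqn_exp2l ?card_finNzRing_gt1 // => /eqP ->.
Qed.

End Degree.

(** * The Hecke modifications at a point of degree five *)

Lemma isomorphic_multiplicity (F : fieldType) (x : closed_point F)
    (E' E'' E : omodule (structure_sheaf F)) (n : nat) :
  isomorphic E' E'' -> has_multiplicity x E' E n -> has_multiplicity x E'' E n.
Proof.
move=> iso [s [sE inj surj]]; exists s; split=> // [i|t tE].
  exact: isomorphic_trans (sE i) iso.
by apply: surj; apply: isomorphic_trans tE (isomorphic_sym iso).
Qed.

Theorem mainTheorem1 (F : finFieldType) (x : closed_point F)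
    (x_deg5 : has_degree x 5) :
  let q := #|F| in
  let OX := self_module (structure_sheaf F) in
  (forall E' : omodule (structure_sheaf F),
     hecke_modification x E' (dsum OX OX) <->
     [\/ isomorphic E' (dsum (O_ (- 5)) OX),
         isomorphic E' (dsum (O_ (- 4)) (O_ (- 1)))
       | isomorphic E' (dsum (O_ (- 3)) (O_ (- 2)))]) /\
  [/\ has_multiplicity x (dsum (O_ (- 5)) OX) (dsum OX OX) (q + 1)%N,
      has_multiplicity x (dsum (O_ (- 4)) (O_ (- 1))) (dsum OX OX) (q ^ 3 - q)%N
    & has_multiplicity x (dsum (O_ (- 3)) (O_ (- 2))) (dsum OX OX)
        (q ^ 5 - q ^ 3)%N].
Proof.
case: x x_deg5 => [p|] deg; last by have := degree_infinity deg.
have sp := degree_finite deg; move=> q OX.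
have q1 : (1 < q)%N by exact: card_finNzRing_gt1.
have iso0 : isomorphic (split_bundle F 5 0) (dsum (O_ (- 5)) OX).
  apply: isomorphic_dsum; first exact: isomorphic_refl.
  by apply: isomorphic_sym; exact: self_module_O0.
have qE : ((q.-1 * q * q.+1) = q ^ 3 - q)%N.
  by rewrite -(prednK (ltnW q1)) /=; nia.
have s0 : #|stratum p 5 0| = (q + 1)%N by rewrite card_stratum0 // addn1.
have s1 : #|stratum p 5 1| = (q ^ 3 - q)%N by rewrite card_stratum1.
have s2 : #|stratum p 5 2| = (q ^ 5 - q ^ 3)%N.
  (* The heights of the q^5 + 1 points are at most 5 / 2. *)
  have : (#|stratum p 5 0| + (#|stratum p 5 1| + #|stratum p 5 2|) = (q ^ 5).+1)%N.
    by rewrite -(stratum_partition sp isT) !big_ord_recl big_ord0 addn0.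
  rewrite s0 s1.
  have : (q <= q ^ 3)%N by rewrite -{1}(expn1 q) leq_exp2l.
  rewrite -/q; lia.
have mult d (dN : (d.*2 <= 5)%N) := multiplicity_split_bundle sp isT dN.
split=> [E'|]; last first.
  split.
  - by rewrite -s0; apply: isomorphic_multiplicity iso0 _; exact: mult.
  - by rewrite -s1; exact: (mult 1%N).
  - by rewrite -s2; exact: (mult 2%N).
have q3 : (q < q ^ 3)%N by rewrite -{1}(expn1 q) ltn_exp2l.
have q5 : (q ^ 3 < q ^ 5)%N by rewrite ltn_exp2l.
rewrite (hecke_split_bundle sp) //; split.
  move=> [[|[|[|d]]] [d5 _ iso]] //.
  - by apply: Or31; exact: isomorphic_trans iso iso0.
  - exact: Or32.
  - exact: Or33.
case=> iso.
- exists 0%N; split; rewrite ?s0 ?addn1 //.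
  exact: isomorphic_trans iso (isomorphic_sym iso0).
- by exists 1%N; split; rewrite ?s1 ?subn_gt0.
- by exists 2%N; split; rewrite ?s2 ?subn_gt0.
Qed.
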